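(* Let $d\ge 2$, let $K\subseteq\mathbb{R}^d$ be a convex body, and let $k$ be a positive integer with $k\le d(\ln d+\ln\ln d)$. Then \[\vartheta^{(k)}(K)\le 6ed(3\ln d+\ln\ln d+15).\]
   Context: A convex body is a compact convex subset of $\mathbb{R}^d$ with nonempty interior. A $k$-fold covering of $\mathbb{R}^d$ is a family of sets such that every point of $\mathbb{R}^d$ belongs to at least $k$ of them (counted with multiplicity). Its density is $\limsup_{r\to\infty}\frac{\sum_{i:\,C_i\subseteq rB}\operatorname{vol}(C_i)}{\operatorname{vol}(rB)}$, $B$ the Euclidean unit ball. $\vartheta^{(k)}(K)$ denotes the infimum of the densities of $k$-fold coverings of $\mathbb{R}^d$ by translates of $K$. *)

(* Defs.v *)
(* classical reals. R^d is encoded as functions nat -> R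
   whose coordinates of index >= d vanish. *)
From Stdlib Require Import Reals Lra Lia ZArith List.
Open Scope R_scope.

Fixpoint sumR (n : nat) (f : nat -> R) : R :=
  match n with O => 0 | S m => sumR m f + f m end.

Definition inRd (d : nat) (x : nat -> R) : Prop :=
  forall i, (d <= i)%nat -> x i = 0.

Definition vadd (x y : nat -> R) : nat -> R := fun i => x i + y i.
Definition vsub (x y : nat -> R) : nat -> R := fun i => x i - y i.

Definition norm (d : nat) (x : nat -> R) : R :=
  sqrt (sumR d (fun i => x i * x i)).

Definition cball (d : nat) (a : nat -> R) (r : R) (x : nat -> R) : Prop :=
  inRd d x /\ norm d (vsub x a) <= r.

Definition rB (d : nat) (r : R) : (nat -> R) -> Prop :=
  cball d (fun _ => 0) r.

Definition is_open_Rd (d : nat) (U : (nat -> R) -> Prop) : Prop :=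
  forall x, inRd d x -> U x -> exists e, 0 < e /\
    forall y, inRd d y -> norm d (vsub y x) < e -> U y.

Definition is_closed_Rd (d : nat) (S : (nat -> R) -> Prop) : Prop :=
  is_open_Rd d (fun x => ~ S x).

Definition is_bounded_Rd (d : nat) (S : (nat -> R) -> Prop) : Prop :=
  exists M, forall x, S x -> norm d x <= M.

(* compact subset of R^d (Heine-Borel: closed and bounded) *)
Definition is_compact_Rd (d : nat) (S : (nat -> R) -> Prop) : Prop :=
  (forall x, S x -> inRd d x) /\ is_closed_Rd d S /\ is_bounded_Rd d S.

Definition is_convex (d : nat) (S : (nat -> R) -> Prop) : Prop :=
  forall x y t, S x -> S y -> 0 <= t <= 1 ->
    S (fun i => (1 - t) * x i + t * y i).

Definition nonempty_interior (d : nat) (S : (nat -> R) -> Prop) : Prop :=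
  exists a e, inRd d a /\ 0 < e /\ forall x, cball d a e x -> S x.

Definition convex_body (d : nat) (K : (nat -> R) -> Prop) : Prop :=
  is_compact_Rd d K /\ is_convex d K /\ nonempty_interior d K.

Definition dcube (d n : nat) (z : list Z) (x : nat -> R) : Prop :=
  inRd d x /\ forall i, (i < d)%nat ->
    IZR (nth i z 0%Z) / 2 ^ n <= x i <= (IZR (nth i z 0%Z) + 1) / 2 ^ n.

(* v is the d-dimensional volume of S (inner Jordan measure, which equals
   Lebesgue measure for convex bodies and balls) *)
Definition is_vol (d : nat) (S : (nat -> R) -> Prop) (v : R) : Prop :=
  is_lub (fun a => exists (n : nat) (l : list (list Z)),
            NoDup l /\
            (forall z, In z l -> length z = d /\ forall x, dcube d n z x -> S x) /\
            a = INR (length l) / 2 ^ (n * d)) v.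

Definition kfold_covering (d k : nat) (K : (nat -> R) -> Prop)
    (c : nat -> (nat -> R)) : Prop :=
  (forall i, inRd d (c i)) /\
  forall x, inRd d x -> exists l : list nat,
    NoDup l /\ length l = k /\ forall i, In i l -> K (vsub x (c i)).

(* the density  limsup_{r->oo} sum_{i : K + c i ⊆ rB} vol(K + c i) / vol(rB)
   is at most D  (vol(K + c i) = vol K) *)
Definition density_le (d : nat) (K : (nat -> R) -> Prop)
    (c : nat -> (nat -> R)) (D : R) : Prop :=
  forall eps, 0 < eps -> exists R0, forall r, R0 <= r ->
    forall vK vB, is_vol d K vK -> is_vol d (rB d r) vB ->
    forall l : list nat, NoDup l ->
      (forall i, In i l -> forall y, K y -> rB d r (vadd y (c i))) ->
      vK * INR (length l) / vB <= D + eps.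

(* theta^(k)(K) <= D : the infimum of densities of k-fold translative
   coverings by K is at most D *)
Definition theta_le (d k : nat) (K : (nat -> R) -> Prop) (D : R) : Prop :=
  forall eps, 0 < eps -> exists c : nat -> (nat -> R),
    kfold_covering d k K c /\ density_le d K c (D + eps).

(* Main.v *)
Require Import Defs.
From Stdlib Require Import Reals Lra Lia ZArith List Cantor Classical FunctionalExtensionality.
Import ListNotations.
Open Scope R_scope.

(** Work on a torus made of fine dyadic cubes of side h. Let K_0 = (1 - 2^(-j)) K with 2^j of order d, so
    that vol K_0 >= vol K / 2. Choosing translates of K_0 greedily, so as to decrease the potential
    sum_y 2^(-#(translates covering y)), makes the set U of points covered fewer than k times exponentially
    small after density O(k + d ln d). Averaging over sums of two cubes in K gives a centre s for which
    K meets s - K in volume at least about 2^(-d) vol K; let W be this intersection shrunk by 2^(-j), a set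
    of relative volume at least (8d)^(-d) / 4. If x is not covered k times by K, then x - W lies in U,
    because K_0 + W is contained in K. A maximal family of disjoint x_i - W thus has few members, and every
    remaining bad x lies in some x_i + W - W, which by the symmetry of W fits into a translate of K; taking
    k copies of those translates completes the k-fold covering at negligible cost. *)

(** * Greedy covering and packing in finite sets *)

Fixpoint sumL {A : Type} (l : list A) (f : A -> R) : R :=
  match l with [] => 0 | x :: l' => f x + sumL l' f end.

Definition indic (b : bool) : R := if b then 1 else 0.

Lemma sumL_ext {A} (l : list A) (f g : A -> R) :
  (forall x, In x l -> f x = g x) -> sumL l f = sumL l g.
Proof.
  induction l as [|x l IH]; simpl; intros H; [reflexivity|].
  rewrite H, IH; auto.
Qed.

Lemma sumL_le {A} (l : list A) (f g : A -> R) :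
  (forall x, In x l -> f x <= g x) -> sumL l f <= sumL l g.
Proof.
  induction l as [|x l IH]; simpl; intros H; [lra|].
  apply Rplus_le_compat; auto.
Qed.

Lemma sumL_plus {A} (l : list A) (f g : A -> R) :
  sumL l (fun x => f x + g x) = sumL l f + sumL l g.
Proof. induction l as [|x l IH]; simpl; [lra|]. rewrite IH; lra. Qed.

Lemma sumL_scal {A} (l : list A) (c : R) (f : A -> R) :
  sumL l (fun x => c * f x) = c * sumL l f.
Proof. induction l as [|x l IH]; simpl; [lra|]. rewrite IH; lra. Qed.

Lemma sumL_const {A} (l : list A) (c : R) : sumL l (fun _ => c) = INR (length l) * c.
Proof.
  induction l as [|x l IH]; [simpl; lra|].
  change (length (x :: l)) with (S (length l)). rewrite S_INR. simpl. rewrite IH; lra.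
Qed.

Lemma sumL_swap {A B} (l : list A) (m : list B) (f : A -> B -> R) :
  sumL l (fun x => sumL m (f x)) = sumL m (fun y => sumL l (fun x => f x y)).
Proof.
  induction l as [|x l IH]; simpl.
  - induction m as [|y m IHm]; simpl; lra.
  - rewrite IH, <- sumL_plus. reflexivity.
Qed.

Lemma sumL_indic {A} (l : list A) (f : A -> bool) :
  sumL l (fun x => indic (f x)) = INR (length (filter f l)).
Proof.
  induction l as [|x l IH]; [reflexivity|].
  cbn [sumL filter]. rewrite IH. destruct (f x); unfold indic; cbn [length]; [rewrite S_INR|]; lra.
Qed.

Lemma exists_le_average {A} (l : list A) (f : A -> R) (c : R) :
  l <> [] -> sumL l f <= INR (length l) * c -> exists x, In x l /\ f x <= c.
Proof.
  intros Hl H. apply NNPP. intros Hn.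
  assert (Hgt : forall x, In x l -> c < f x).
  { intros x Hx. apply Rnot_le_lt. intros Hle. apply Hn. eauto. }
  assert (INR (length l) * c < sumL l f); [|lra].
  clear H Hn. induction l as [|x l IH]; [congruence|].
  change (length (x :: l)) with (S (length l)). rewrite S_INR. cbn [sumL].
  pose proof (Hgt x (or_introl eq_refl)).
  destruct l as [|y l]; [simpl in *; lra|].
  assert (INR (length (y :: l)) * c < sumL (y :: l) f); [|lra].
  apply IH; [congruence|]. intros z Hz. apply Hgt. now right.
Qed.

Lemma exists_ge_average {A} (l : list A) (f : A -> R) (c : R) :
  l <> [] -> INR (length l) * c <= sumL l f -> exists x, In x l /\ c <= f x.
Proof.
  intros Hl H.
  destruct (exists_le_average l (fun x => (-1) * f x) (- c)) as (x & Hx & Hc); auto.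
  - rewrite sumL_scal. lra.
  - exists x. split; auto. lra.
Qed.

Definition cover_count {A B} (cov : B -> A -> bool) (L : list B) (y : A) : nat :=
  length (filter (fun t => cov t y) L).

(* Derandomized first moment method: the potential [sum_y 2^(-cover_count y)]
   drops by the factor [1 - a / (2 |T|)] on average over the next translate. *)
Lemma greedy_cover {A B} (P : list A) (T : list B) (cov : B -> A -> bool) (a : R) :
  T <> [] -> a <= INR (length T) ->
  (forall y, In y P -> a <= INR (length (filter (fun t => cov t y) T))) ->
  forall m, exists L, length L = m /\ incl L T /\
    sumL P (fun y => (/ 2) ^ cover_count cov L y)
      <= INR (length P) * (1 - a / (2 * INR (length T))) ^ m.
Proof.
  intros HT HaT Ha m.
  assert (HTpos : 0 < INR (length T)).
  { apply lt_0_INR. destruct T; [congruence|simpl; lia]. }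
  induction m as [|m (L & HL & Hincl & Hsum)].
  - exists []. split; [reflexivity|]. split; [intros x []|].
    unfold cover_count; simpl. rewrite sumL_const. lra.
  - set (w := fun y => (/ 2) ^ cover_count cov L y) in *.
    assert (Hw : forall y, 0 < w y) by (intros y; apply pow_lt; lra).
    destruct (exists_le_average T
      (fun t => sumL P (fun y => w y * (1 - indic (cov t y) * / 2)))
      ((1 - a / (2 * INR (length T))) * sumL P w)) as (t & Ht & Hle); auto.
    + rewrite sumL_swap.
      replace (INR (length T) * ((1 - a / (2 * INR (length T))) * sumL P w))
        with ((INR (length T) - a / 2) * sumL P w) by (field; lra).
      rewrite <- sumL_scal. apply sumL_le. intros y Hy.
      (* Adding [t] halves the weight of every point that it covers. Summed over all [t], the
         factors at [y] give |T| minus half the number of translates covering [y], hence at most |T|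
         - a/2. *)
      rewrite sumL_scal, (sumL_ext T _ (fun t => 1 + (- / 2) * indic (cov t y)))
        by (intros; ring).
      rewrite sumL_plus, sumL_scal, sumL_const, sumL_indic.
      specialize (Ha y Hy). specialize (Hw y). nra.
    + exists (t :: L). split; [simpl; congruence|]. split.
      { intros x [<-|Hx]; auto. }
      rewrite (sumL_ext P _ (fun y => w y * (1 - indic (cov t y) * / 2))).
      * apply Rle_trans with (1 := Hle). simpl.
        rewrite <- Rmult_assoc, (Rmult_comm (INR (length P))), Rmult_assoc.
        apply Rmult_le_compat_l; auto.
        assert (a / (2 * INR (length T)) <= 1); [|lra].
        apply Rmult_le_reg_r with (2 * INR (length T)); [lra|].
        unfold Rdiv. rewrite Rmult_assoc, Rinv_l by lra. lra.
      * intros y _. unfold w, cover_count. simpl. destruct (cov t y); simpl; lra.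
Qed.

(** Markov's inequality: a point covered fewer than [k] times contributes more than 2^(-k) to the
    potential. *)
Lemma filter_lt_count {A B} (P : list A) (cov : B -> A -> bool) (L : list B) (k : nat) :
  INR (length (filter (fun y => Nat.ltb (cover_count cov L y) k) P))
    <= 2 ^ k * sumL P (fun y => (/ 2) ^ cover_count cov L y).
Proof.
  rewrite <- sumL_indic, <- sumL_scal. apply sumL_le. intros y _.
  assert (H2 : forall n, 0 < (/ 2) ^ n) by (intros; apply pow_lt; lra).
  assert (H2' : forall n, 0 < 2 ^ n) by (intros; apply pow_lt; lra).
  destruct (Nat.ltb_spec (cover_count cov L y) k) as [H|H]; unfold indic.
  - rewrite pow_inv.
    apply Rmult_le_reg_r with (2 ^ cover_count cov L y); auto.
    rewrite Rmult_assoc, Rinv_l by (apply Rgt_not_eq, H2').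
    rewrite Rmult_1_l, Rmult_1_r. apply Rle_pow; [lra|lia].
  - specialize (H2 (cover_count cov L y)). specialize (H2' k). nra.
Qed.

(** Scan [Q] and keep a point whenever its neighbourhood misses those already kept. Disjointness is
    phrased as a multiplicity bound at each [y], the form needed for double counting. Nonempty
    neighbourhoods let a kept point serve as its own witness in the last clause. *)
Lemma maximal_packing {A B} (P : list A) (Q : list B) (nb : B -> A -> bool) :
  (forall x, In x Q -> exists y, In y P /\ nb x y = true) ->
  exists X, incl X Q /\
    (forall y, sumL X (fun x => indic (nb x y)) <= 1 \/ ~ In y P) /\
    forall x, In x Q -> exists x' y,
      In x' X /\ In y P /\ nb x y = true /\ nb x' y = true.
Proof.
  induction Q as [|x Q IH]; intros HQ.
  - exists []. split; [intros x []|]. split; [intros y; left; simpl; lra|intros x []].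
  - destruct IH as (X & HX & Hdis & Hmax). { intros z Hz; apply HQ; now right. }
    destruct (classic (exists x' y, In x' X /\ In y P /\ nb x y = true /\ nb x' y = true))
      as [Hex|Hno].
    + exists X. split; [intros z Hz; right; auto|]. split; auto.
      intros z [<-|Hz]; auto.
    + exists (x :: X). split; [intros z [<-|Hz]; [left|right]; auto|]. split.
      * intros y. destruct (classic (In y P)) as [Hy|Hy]; [left|now right].
        simpl. destruct (nb x y) eqn:E; unfold indic at 1.
        -- rewrite (sumL_ext X _ (fun _ => 0)), sumL_const; [lra|].
           intros x' Hx'. destruct (nb x' y) eqn:E'; [|reflexivity].
           exfalso. apply Hno. exists x', y. auto.
        -- destruct (Hdis y); [lra|tauto].
      * intros z [<-|Hz].
        -- destruct (HQ x (or_introl eq_refl)) as (y & Hy & Hxy).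
           exists x, y. repeat split; auto. now left.
        -- destruct (Hmax z Hz) as (x' & y & H1 & H2 & H3 & H4).
           exists x', y. repeat split; auto. now right.
Qed.

(* Rogers' alteration: the points that [L] fails to cover k-fold, together with
   a whole neighbourhood, are handled by a maximal packing of neighbourhoods. *)
Lemma cover_or_near_packing {A B} (P : list A) (T : list B)
    (cov : B -> A -> bool) (nb : A -> A -> bool) (a b : R) (k m : nat) :
  T <> [] -> a <= INR (length T) -> 0 < b ->
  (forall y, In y P -> a <= INR (length (filter (fun t => cov t y) T))) ->
  (forall x, In x P -> b <= INR (length (filter (nb x) P))) ->
  exists L X, length L = m /\ incl L T /\ incl X P /\
    INR (length X) * b
      <= 2 ^ k * (INR (length P) * (1 - a / (2 * INR (length T))) ^ m) /\
    forall x, In x P ->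
      (exists y, In y P /\ nb x y = true /\ (k <= cover_count cov L y)%nat) \/
      (exists x' y, In x' X /\ In y P /\ nb x y = true /\ nb x' y = true).
Proof.
  intros HT HaT Hb Ha HbP.
  destruct (greedy_cover P T cov a HT HaT Ha m) as (L & HL & Hincl & Hsum).
  set (bad := fun y => Nat.ltb (cover_count cov L y) k).
  (* The points whose whole neighbourhood is bad; any other point has a neighbour covered at least
     [k] times, which is the first alternative. *)
  set (Q := filter (fun x => forallb (fun y => implb (nb x y) (bad y)) P) P).
  assert (Hne : forall x, In x P -> exists y, In y P /\ nb x y = true).
  { intros x Hx. specialize (HbP x Hx).
    destruct (filter (nb x) P) as [|y l] eqn:E; [simpl in HbP; lra|].
    exists y. apply filter_In. rewrite E. now left. }
  destruct (maximal_packing P Q nb) as (X & HXQ & Hdis & Hmax).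
  { intros x Hx. apply filter_In in Hx. apply Hne, Hx. }
  exists L, X. split; auto. split; auto.
  assert (HXP : incl X P).
  { intros x Hx. apply HXQ in Hx. apply filter_In in Hx. apply Hx. }
  split; auto. split.
  - apply Rle_trans with (INR (length (filter bad P))).
    (* Double counting: the neighbourhoods of the points of [X] are disjoint, consist of bad points,
       and have at least [b] elements each. *)
    + rewrite <- sumL_const.
      apply Rle_trans with (sumL X (fun x => sumL P (fun y => indic (nb x y) * indic (bad y)))).
      * apply sumL_le. intros x Hx. apply Rle_trans with (1 := HbP x (HXP x Hx)).
        rewrite <- sumL_indic. apply sumL_le. intros y Hy.
        apply HXQ in Hx. apply filter_In in Hx. destruct Hx as [_ Hx].
        rewrite forallb_forall in Hx. specialize (Hx y Hy).
        destruct (nb x y), (bad y); unfold indic; simpl in Hx; try discriminate; lra.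
      * rewrite sumL_swap, <- sumL_indic. apply sumL_le. intros y Hy.
        rewrite (sumL_ext X _ (fun x => indic (bad y) * indic (nb x y))) by (intros; ring).
        rewrite sumL_scal. destruct (Hdis y) as [H|H]; [|tauto].
        destruct (bad y); unfold indic at 1 3; lra.
    + apply Rle_trans with (1 := filter_lt_count P cov L k).
      apply Rmult_le_compat_l; auto. apply pow_le; lra.
  - intros x Hx.
    destruct (forallb (fun y => implb (nb x y) (bad y)) P) eqn:E.
    + right. apply Hmax. apply filter_In. auto.
    + left. apply NNPP. intros Hno.
      enough (forallb (fun y => implb (nb x y) (bad y)) P = true) by congruence.
      apply forallb_forall. intros y Hy.
      destruct (nb x y) eqn:E1; auto. simpl.
      destruct (bad y) eqn:E2; auto. exfalso. apply Hno. exists y.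
      repeat split; auto. unfold bad in E2. apply Nat.ltb_ge in E2. exact E2.
Qed.

(** * Integer vectors and the discrete torus *)

Definition mkv (d : nat) (g : nat -> Z) : list Z := map g (seq 0 d).

Lemma length_mkv d g : length (mkv d g) = d.
Proof. unfold mkv. now rewrite length_map, length_seq. Qed.

Lemma nth_mkv d g i : (i < d)%nat -> nth i (mkv d g) 0%Z = g i.
Proof.
  intros Hi. unfold mkv. rewrite (nth_indep _ 0%Z (g 0%nat)) by now rewrite length_map, length_seq.
  rewrite map_nth, seq_nth; auto.
Qed.

Lemma vec_ext d (u v : list Z) :
  length u = d -> length v = d ->
  (forall i, (i < d)%nat -> nth i u 0%Z = nth i v 0%Z) -> u = v.
Proof. intros Hu Hv H. apply nth_ext with 0%Z 0%Z; [lia|]. intros i Hi. apply H. lia. Qed.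

(** Representatives of the torus (Z/MZ)^d. They will serve both as the points to be covered and as
    the candidate translates. *)
Fixpoint box (d M : nat) : list (list Z) :=
  match d with
  | O => [[]]
  | S d' => map (fun p => Z.of_nat (fst p) :: snd p) (list_prod (seq 0 M) (box d' M))
  end.

Lemma length_box d M : length (box d M) = (M ^ d)%nat.
Proof.
  induction d as [|d IH]; [reflexivity|]. simpl.
  now rewrite length_map, length_prod, length_seq, IH.
Qed.

Lemma NoDup_prod {A B} (l : list A) (m : list B) :
  NoDup l -> NoDup m -> NoDup (list_prod l m).
Proof.
  intros Hl Hm. induction Hl as [|x l Hx Hl IH]; simpl; [constructor|].
  apply NoDup_app; auto.
  - apply NoDup_map_NoDup_ForallPairs; auto. intros u v _ _ E. congruence.
  - intros [u v] H1 H2. apply in_map_iff in H1. destruct H1 as (w & E & _).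
    apply in_prod_iff in H2. inversion E; subst. tauto.
Qed.

Lemma NoDup_box d M : NoDup (box d M).
Proof.
  induction d as [|d IH]; simpl; [repeat constructor; intros []|].
  apply NoDup_map_NoDup_ForallPairs.
  - intros [u v] [u' v'] _ _ E. simpl in E. inversion E. f_equal; lia.
  - apply NoDup_prod; auto using seq_NoDup.
Qed.

Lemma in_box d M z :
  In z (box d M) <->
  length z = d /\ forall i, (i < d)%nat -> (0 <= nth i z 0 < Z.of_nat M)%Z.
Proof.
  revert z; induction d as [|d IH]; intros z; simpl.
  - split.
    + intros [<-|[]]. split; [reflexivity|lia].
    + intros [H _]. destruct z; [now left|discriminate].
  - rewrite in_map_iff. split.
    + intros ([a v] & <- & H). apply in_prod_iff in H. destruct H as [Ha Hv].
      apply in_seq in Ha. apply IH in Hv. destruct Hv as [Hl Hv]. simpl.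
      split; [congruence|]. intros [|i] Hi; [lia|apply Hv; lia].
    + intros [Hl H]. destruct z as [|a v]; [discriminate|].
      exists (Z.to_nat a, v). pose proof (H 0%nat ltac:(lia)) as H0. simpl in H0.
      split; [simpl; f_equal; lia|]. apply in_prod_iff. split.
      * apply in_seq. lia.
      * apply IH. split; [simpl in Hl; lia|]. intros i Hi. apply (H (S i)). lia.
Qed.

(* Each cube of [l] is cut into [lam ^ d] cubes, indexed in coordinates scaled by [lam]. *)
Definition subdiv (d lam : nat) (l : list (list Z)) : list (list Z) :=
  map (fun p => mkv d (fun i => Z.of_nat lam * nth i (fst p) 0 + nth i (snd p) 0)%Z)
    (list_prod l (box d lam)).

Lemma length_subdiv d lam l : length (subdiv d lam l) = (length l * lam ^ d)%nat.
Proof. unfold subdiv. now rewrite length_map, length_prod, length_box. Qed.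

Lemma in_subdiv d lam l z :
  In z (subdiv d lam l) -> length z = d /\ exists y, In y l /\
    forall i, (i < d)%nat ->
      (Z.of_nat lam * nth i y 0 <= nth i z 0 < Z.of_nat lam * (nth i y 0 + 1))%Z.
Proof.
  intros H. apply in_map_iff in H. destruct H as ([y e] & <- & H).
  apply in_prod_iff in H. destruct H as [Hy He]. apply in_box in He.
  split; [apply length_mkv|]. exists y. split; auto.
  intros i Hi. rewrite nth_mkv by auto. simpl. destruct He as [_ He].
  specialize (He i Hi). nia.
Qed.

Lemma NoDup_subdiv d lam l :
  NoDup l -> (forall z, In z l -> length z = d) -> NoDup (subdiv d lam l).
Proof.
  intros Hl Hd. apply NoDup_map_NoDup_ForallPairs.
  - intros [y e] [y' e'] H H' E.
    apply in_prod_iff in H, H'. destruct H as [Hy He], H' as [Hy' He'].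
    apply in_box in He, He'. destruct He as [Le He], He' as [Le' He'].
    assert (Hi : forall i, (i < d)%nat ->
      nth i y 0%Z = nth i y' 0%Z /\ nth i e 0%Z = nth i e' 0%Z).
    { intros i Hi. apply (f_equal (fun v => nth i v 0%Z)) in E.
      rewrite !nth_mkv in E by auto. simpl in E.
      specialize (He i Hi). specialize (He' i Hi).
      (* Uniqueness of Euclidean division by [lam]: the entries of [e] and [e'] are remainders. *)
      assert (nth i y 0%Z = nth i y' 0%Z) by nia. split; nia. }
    f_equal; apply vec_ext with d; auto; intros; apply Hi; auto.
  - apply NoDup_prod; auto using NoDup_box.
Qed.

Definition vecadd d u v := mkv d (fun i => nth i u 0 + nth i v 0)%Z.
Definition vecsub d u v := mkv d (fun i => nth i u 0 - nth i v 0)%Z.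

Definition vec_dec : forall u v : list Z, {u = v} + {u <> v} := list_eq_dec Z.eq_dec.
Definition memb (z : list Z) (l : list (list Z)) : bool :=
  if in_dec vec_dec z l then true else false.

Lemma memb_In z l : memb z l = true <-> In z l.
Proof. unfold memb. destruct (in_dec vec_dec z l); split; intros; auto; discriminate. Qed.

(** Membership of [y] in [t + D] modulo [M], stated as membership of [t] in the list of residues of
    [y - D], so that the related [t] can be counted. It expresses both covering by translates of [D]
    and the neighbourhood [y - D] of [y]. *)
Definition modrel (d M : nat) (D : list (list Z)) (y t : list Z) : bool :=
  memb t (map (fun z => mkv d (fun i => (nth i y 0 - nth i z 0) mod Z.of_nat M)%Z) D).

Lemma modrel_spec d M D y t : (0 < M)%nat ->
  modrel d M D y t = true ->
  exists z v, In z D /\ length v = d /\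
    forall i, (i < d)%nat -> (nth i y 0 = nth i t 0 + nth i z 0 + Z.of_nat M * nth i v 0)%Z.
Proof.
  intros HM H. apply memb_In, in_map_iff in H. destruct H as (z & <- & Hz).
  exists z, (mkv d (fun i => (nth i y 0 - nth i z 0) / Z.of_nat M)%Z).
  split; auto. split; [apply length_mkv|]. intros i Hi. rewrite !nth_mkv by auto.
  pose proof (Z.div_mod (nth i y 0 - nth i z 0)%Z (Z.of_nat M) ltac:(lia)). lia.
Qed.

(** Reduction modulo [M] is injective on [y - D], because the coordinates of two elements of [D]
    differ by less than [M]. *)
Lemma modrel_count d M D y : (0 < M)%nat -> NoDup D ->
  (forall z, In z D -> length z = d) ->
  (forall z z' i, In z D -> In z' D -> (i < d)%nat ->
     (Z.abs (nth i z 0 - nth i z' 0) < Z.of_nat M)%Z) ->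
  (length D <= length (filter (modrel d M D y) (box d M)))%nat.
Proof.
  intros HM HD Hl Hdiam.
  rewrite <- (length_map (fun z => mkv d (fun i => (nth i y 0 - nth i z 0) mod Z.of_nat M)%Z) D).
  apply NoDup_incl_length.
  - apply NoDup_map_NoDup_ForallPairs; auto. intros z z' Hz Hz' E.
    apply vec_ext with d; auto. intros i Hi.
    apply (f_equal (fun v => nth i v 0%Z)) in E. rewrite !nth_mkv in E by auto.
    specialize (Hdiam z z' i Hz Hz' Hi).
    pose proof (Z.div_mod (nth i y 0 - nth i z 0)%Z (Z.of_nat M) ltac:(lia)) as E1.
    pose proof (Z.div_mod (nth i y 0 - nth i z' 0)%Z (Z.of_nat M) ltac:(lia)) as E2.
    rewrite E in E1.
    set (q := ((nth i y 0 - nth i z 0) / Z.of_nat M)%Z) in *.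
    set (q' := ((nth i y 0 - nth i z' 0) / Z.of_nat M)%Z) in *.
    assert (q = q') by nia. subst q. rewrite H in E1. lia.
  - intros t Ht. apply filter_In. split; [|now apply memb_In].
    apply in_map_iff in Ht. destruct Ht as (z & <- & Hz). apply in_box.
    split; [apply length_mkv|]. intros i Hi. rewrite nth_mkv by auto.
    apply Z.mod_pos_bound. lia.
Qed.

Lemma vec_list_bound d (l : list (list Z)) :
  exists M, forall z i, In z l -> (i < d)%nat -> (Z.abs (nth i z 0) < Z.of_nat M)%Z.
Proof.
  induction l as [|z l (M & HM)]; [exists 0%nat; intros z i []|].
  assert (Hz : exists M', forall i, (i < d)%nat -> (Z.abs (nth i z 0) < Z.of_nat M')%Z).
  { clear HM. induction d as [|d (M' & IH)]; [exists 0%nat; lia|].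
    exists (M' + Z.to_nat (Z.abs (nth d z 0%Z)) + 1)%nat. intros i Hi.
    destruct (Nat.eq_dec i d) as [->|]; [lia|]. specialize (IH i ltac:(lia)). lia. }
  destruct Hz as (M' & HM'). exists (M + M')%nat. intros y i [<-|Hy] Hi.
  - specialize (HM' i Hi). lia.
  - specialize (HM y i Hy Hi). lia.
Qed.

(* [s] is an approximate centre of symmetry of [l]. *)
Lemma popular_sum d (l : list (list Z)) :
  l <> [] -> NoDup l -> (forall z, In z l -> length z = d) ->
  exists s Sig, NoDup Sig /\
    (forall z, In z Sig -> exists a b, In a l /\ In b l /\ z = vecadd d a b) /\
    INR (length l) * INR (length l)
      <= INR (length Sig) * INR (length (filter (fun a => memb (vecsub d s a) l) l)).
Proof.
  intros Hne Hnd Hl.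
  set (Sig := nodup vec_dec (map (fun p => vecadd d (fst p) (snd p)) (list_prod l l))).
  assert (HSig : forall a b, In a l -> In b l -> In (vecadd d a b) Sig).
  { intros a b Ha Hb. apply nodup_In, in_map_iff. exists (a, b).
    split; [reflexivity|]. now apply in_prod_iff. }
  assert (HSne : Sig <> []).
  { destruct l as [|a l]; [congruence|].
    specialize (HSig a a (or_introl eq_refl) (or_introl eq_refl)).
    intros E. rewrite E in HSig. destruct HSig. }
  assert (Hpos : 0 < INR (length Sig)).
  { apply lt_0_INR. destruct Sig; [congruence|simpl; lia]. }
  (* Each [a] in [l] occurs in |l| representations a + b, so the |l|^2 pairs spread over the sums in
     [Sig]; some sum [s] receives at least the average number. *)
  destruct (exists_ge_average Sig
    (fun s => sumL l (fun a => indic (memb (vecsub d s a) l)))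
    (INR (length l) * INR (length l) / INR (length Sig))) as (s & _ & Hs); auto.
  - replace (INR (length Sig) * _) with (INR (length l) * INR (length l)) by (field; lra).
    rewrite sumL_swap, <- sumL_const. apply sumL_le. intros a Ha.
    rewrite sumL_indic. apply le_INR. rewrite <- (length_map (vecadd d a) l).
    apply NoDup_incl_length.
    + apply NoDup_map_NoDup_ForallPairs; auto. intros b b' Hb Hb' E.
      apply vec_ext with d; auto. intros i Hi.
      apply (f_equal (fun v => nth i v 0%Z)) in E. unfold vecadd in E.
      rewrite !nth_mkv in E by auto. lia.
    + intros z Hz. apply in_map_iff in Hz. destruct Hz as (b & <- & Hb).
      apply filter_In. split; auto. apply memb_In.
      replace (vecsub d (vecadd d a b) a) with b; auto.
      unfold vecsub, vecadd. apply vec_ext with d; auto using length_mkv. intros i Hi.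
      rewrite !nth_mkv by auto. lia.
  - exists s, Sig. split; [apply NoDup_nodup|]. split.
    + intros z Hz. apply nodup_In, in_map_iff in Hz. destruct Hz as ([a b] & <- & Hz).
      apply in_prod_iff in Hz. exists a, b. tauto.
    + rewrite sumL_indic in Hs. apply Rmult_le_compat_l with (r := INR (length Sig)) in Hs; [|lra].
      replace (INR (length Sig) * (_ / _)) with (INR (length l) * INR (length l)) in Hs
        by (field; lra). exact Hs.
Qed.

(** The zigzag bijection from naturals to integers: 0, -1, 1, -2, 2, and so on. *)
Definition zz (n : nat) : Z :=
  if (n mod 2 =? 0)%nat then Z.of_nat (n / 2) else (- Z.of_nat (n / 2) - 1)%Z.

Lemma zz_surj z : exists n, zz n = z.
Proof.
  unfold zz. destruct (Z_le_gt_dec 0 z).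
  - exists (2 * Z.to_nat z)%nat. rewrite Nat.mul_comm, Nat.Div0.mod_mul, Nat.div_mul by lia.
    simpl. lia.
  - exists (1 + Z.to_nat (- z - 1) * 2)%nat.
    rewrite Nat.Div0.mod_add, Nat.div_add by lia. simpl. lia.
Qed.

Lemma zz_inj a b : zz a = zz b -> a = b.
Proof.
  unfold zz. pose proof (Nat.div_mod a 2 ltac:(lia)). pose proof (Nat.div_mod b 2 ltac:(lia)).
  pose proof (Nat.mod_upper_bound a 2 ltac:(lia)). pose proof (Nat.mod_upper_bound b 2 ltac:(lia)).
  destruct (Nat.eqb_spec (a mod 2) 0), (Nat.eqb_spec (b mod 2) 0); lia.
Qed.

(* A bijection onto the integer vectors of length [e + 1]: surjectivity is needed for the covering, injectivity
   for the density, where every lattice vector may be counted only once. *)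
Fixpoint vdec (e : nat) (n : nat) : list Z :=
  match e with
  | O => [zz n]
  | S e' => zz (fst (Cantor.of_nat n)) :: vdec e' (snd (Cantor.of_nat n))
  end.

Lemma length_vdec e n : length (vdec e n) = S e.
Proof. revert n; induction e; intros n; simpl; auto. Qed.

Lemma vdec_surj e v : length v = S e -> exists n, vdec e n = v.
Proof.
  revert v; induction e as [|e IH]; intros [|a v] H; try discriminate; simpl in *.
  - destruct (zz_surj a) as (n & Hn). exists n. destruct v; [|discriminate]. now rewrite Hn.
  - destruct (IH v ltac:(lia)) as (m & Hm). destruct (zz_surj a) as (n & Hn).
    exists (Cantor.to_nat (n, m)). rewrite Cantor.cancel_of_to. simpl. congruence.
Qed.

Lemma vdec_inj e a b : vdec e a = vdec e b -> a = b.
Proof.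
  revert a b; induction e as [|e IH]; simpl; intros a b E.
  - apply zz_inj. congruence.
  - apply Cantor.of_nat_inj.
    destruct (Cantor.of_nat a) as [a1 a2], (Cantor.of_nat b) as [b1 b2]. simpl in E.
    inversion E as [[E1 E2]]. apply zz_inj in E1. apply IH in E2. congruence.
Qed.

(** * Volume by dyadic cubes *)

Lemma sumR_le d f g : (forall i, (i < d)%nat -> f i <= g i) -> sumR d f <= sumR d g.
Proof.
  induction d as [|d IH]; simpl; intros H; [lra|].
  apply Rplus_le_compat; auto.
Qed.

Lemma sumR_affine d f a b : sumR d (fun i => a * f i + b) = a * sumR d f + INR d * b.
Proof. induction d as [|d IH]; [simpl; lra|]. rewrite S_INR. simpl. rewrite IH. lra. Qed.

Lemma sumR_nonneg d f : (forall i, (i < d)%nat -> 0 <= f i) -> 0 <= sumR d f.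
Proof.
  intros H. apply Rle_trans with (sumR d (fun i => 0 * f i + 0)).
  - rewrite sumR_affine. lra.
  - apply sumR_le. intros i Hi. specialize (H i Hi). lra.
Qed.

Lemma Rabs_le_both x a : Rabs x <= a -> - a <= x <= a.
Proof. intros H. pose proof (Rle_abs x). pose proof (Rle_abs (- x)). rewrite Rabs_Ropp in *. lra. Qed.

Lemma sqr_nonneg (x : R) : 0 <= x * x.
Proof. nra. Qed.

Lemma norm_le_sqr d x r : 0 <= r -> (norm d x <= r <-> sumR d (fun i => x i * x i) <= r * r).
Proof.
  intros Hr. unfold norm.
  assert (H0 : 0 <= sumR d (fun i => x i * x i)) by (apply sumR_nonneg; intros; apply sqr_nonneg).
  split; intros H.
  - rewrite <- (sqrt_sqrt _ H0). pose proof (sqrt_pos (sumR d (fun i => x i * x i))). nra.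
  - rewrite <- (sqrt_square r Hr). apply sqrt_le_1; auto. apply sqr_nonneg.
Qed.

Lemma Rabs_coord_le_norm d x i : (i < d)%nat -> Rabs (x i) <= norm d x.
Proof.
  intros Hi. unfold norm. rewrite <- sqrt_Rsqr_abs. apply sqrt_le_1.
  - apply Rle_0_sqr.
  - apply sumR_nonneg; intros; apply sqr_nonneg.
  - induction d as [|d IH]; [lia|]. simpl. destruct (Nat.eq_dec i d) as [->|].
    + assert (0 <= sumR d (fun i => x i * x i)) by (apply sumR_nonneg; intros; apply sqr_nonneg).
      unfold Rsqr. lra.
    + specialize (IH ltac:(lia)). pose proof (sqr_nonneg (x d)). lra.
Qed.

Lemma pow2_pos n : 0 < 2 ^ n.
Proof. apply pow_lt; lra. Qed.

Lemma pow2_ge_INR n : INR n <= 2 ^ n.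
Proof.
  induction n as [|n IH]; [simpl; lra|]. rewrite S_INR. simpl.
  assert (1 <= 2 ^ n) by (apply pow_R1_Rle; lra). lra.
Qed.

(** Bernoulli's inequality. *)
Lemma one_minus_pow x n : 0 <= x <= 1 -> 1 - INR n * x <= (1 - x) ^ n.
Proof.
  intros Hx. induction n as [|n IH]; [simpl; lra|]. rewrite S_INR. simpl.
  pose proof (pos_INR n).
  apply Rle_trans with ((1 - x) * (1 - INR n * x)).
  - assert (0 <= INR n * x * x) by (apply Rmult_le_pos; [apply Rmult_le_pos|]; lra). lra.
  - apply Rmult_le_compat_l; lra.
Qed.

(** The families over which [is_vol] takes its supremum, at a fixed dyadic scale [n]. *)
Definition cubes_in (d n : nat) (K : (nat -> R) -> Prop) (l : list (list Z)) : Prop :=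
  NoDup l /\ forall z, In z l -> length z = d /\ forall x, dcube d n z x -> K x.

Lemma vol_ge_cubes d n K l v :
  is_vol d K v -> cubes_in d n K l -> INR (length l) / 2 ^ (n * d) <= v.
Proof. intros [Hv _] [Hl Hz]. apply Hv. exists n, l. auto. Qed.

Lemma vol_nonneg d K v : is_vol d K v -> 0 <= v.
Proof.
  intros Hv. apply Rle_trans with (INR (length (@nil (list Z))) / 2 ^ (0 * d)); [simpl; lra|].
  apply vol_ge_cubes with K; auto. split; [constructor|intros z []].
Qed.

Lemma vol_approx d K v w :
  is_vol d K v -> w < v -> exists n l, cubes_in d n K l /\ w < INR (length l) / 2 ^ (n * d).
Proof.
  intros [_ Hv] Hw. apply NNPP. intros Hno.
  assert (v <= w); [|lra]. apply Hv. intros a (n & l & H1 & H2 & ->).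
  apply Rnot_lt_le. intros H. apply Hno. exists n, l. split; [split|]; auto.
Qed.

Definition gridpt (d n : nat) (z : list Z) : nat -> R :=
  fun i => if Nat.ltb i d then IZR (nth i z 0%Z) / 2 ^ n else 0.

Lemma gridpt_lt d n z i : (i < d)%nat -> gridpt d n z i = IZR (nth i z 0%Z) / 2 ^ n.
Proof. intros Hi. unfold gridpt. apply Nat.ltb_lt in Hi. now rewrite Hi. Qed.

Lemma gridpt_inRd d n z : inRd d (gridpt d n z).
Proof. intros i Hi. unfold gridpt. apply Nat.ltb_ge in Hi. now rewrite Hi. Qed.

Lemma dcube_gridpt d n z : dcube d n z (gridpt d n z).
Proof.
  split; [apply gridpt_inRd|]. intros i Hi. rewrite gridpt_lt by auto.
  pose proof (pow2_pos n). split; [lra|]. apply Rmult_le_compat_r; [|lra].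
  left. now apply Rinv_0_lt_compat.
Qed.

(** With the denominators cleared, membership in a cube is linear in [x i * 2 ^ n] and the integer
    coordinates. *)
Lemma dcube_iff_scaled d n z x :
  dcube d n z x <-> inRd d x /\ forall i, (i < d)%nat ->
    IZR (nth i z 0%Z) <= x i * 2 ^ n <= IZR (nth i z 0%Z) + 1.
Proof.
  pose proof (pow2_pos n) as Hn. unfold dcube.
  split; intros [H1 H2]; (split; [exact H1|]); intros i Hi; specialize (H2 i Hi); destruct H2 as [H2 H3]; split.
  - apply Rmult_le_compat_r with (r := 2 ^ n) in H2; [|lra].
    unfold Rdiv in H2. rewrite Rmult_assoc, Rinv_l in H2 by lra. lra.
  - apply Rmult_le_compat_r with (r := 2 ^ n) in H3; [|lra].
    unfold Rdiv in H3. rewrite Rmult_assoc, Rinv_l in H3 by lra. lra.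
  - apply Rmult_le_reg_r with (2 ^ n); auto. unfold Rdiv. rewrite Rmult_assoc, Rinv_l by lra. lra.
  - apply Rmult_le_reg_r with (2 ^ n); auto. unfold Rdiv. rewrite Rmult_assoc, Rinv_l by lra. lra.
Qed.

Lemma INR_pow_sub1 j : INR (2 ^ j - 1) = 2 ^ j - 1.
Proof.
  rewrite minus_INR, pow_INR; [rewrite INR_IZR_INZ; simpl; lra|]. pose proof (Nat.pow_nonzero 2 j). lia.
Qed.

Lemma IZR_cube_bounds (lam a b : Z) :
  (lam * a <= b < lam * (a + 1))%Z ->
  IZR lam * IZR a <= IZR b /\ IZR b + 1 <= IZR lam * (IZR a + 1).
Proof.
  intros [H1 H2]. rewrite <- mult_IZR. change 1 with (IZR 1).
  rewrite <- !plus_IZR, <- mult_IZR. split; apply IZR_le; lia.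
Qed.

Definition scale (c : R) (x : nat -> R) : nat -> R := fun i => c * x i.

(* The cubes of [subdiv d (2 ^ j - 1) l] fill [(1 - 2 ^ (-j))] times the cubes of [l] exactly. *)
Lemma dcube_shrink d n j l z x :
  (1 <= j)%nat -> In z (subdiv d (2 ^ j - 1) l) -> dcube d (n + j) z x ->
  exists y, In y l /\ dcube d n y (scale (2 ^ j / (2 ^ j - 1)) x).
Proof.
  intros Hj Hz Hx. apply in_subdiv in Hz. destruct Hz as (Hl & y & Hy & Hyz).
  exists y. split; auto. apply dcube_iff_scaled in Hx. apply dcube_iff_scaled.
  destruct Hx as [Hx0 Hx]. unfold scale.
  assert (Hq : 2 <= 2 ^ j).
  { replace 2 with (2 ^ 1) at 1 by ring. apply Rle_pow; [lra|auto]. }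
  split. { intros i Hi. rewrite Hx0 by auto. ring. }
  intros i Hi. specialize (Hx i Hi). specialize (Hyz i Hi).
  apply IZR_cube_bounds in Hyz. rewrite <- INR_IZR_INZ, INR_pow_sub1 in Hyz.
  rewrite pow_add in Hx.
  set (Y := IZR (nth i y 0%Z)) in *. set (Z' := IZR (nth i z 0%Z)) in *.
  replace (2 ^ j / (2 ^ j - 1) * x i * 2 ^ n) with (x i * (2 ^ n * 2 ^ j) / (2 ^ j - 1)) by (field; lra).
  split.
  - apply Rmult_le_reg_r with (2 ^ j - 1); [lra|]. unfold Rdiv. rewrite Rmult_assoc, Rinv_l by lra. lra.
  - apply Rmult_le_reg_r with (2 ^ j - 1); [lra|]. unfold Rdiv. rewrite Rmult_assoc, Rinv_l by lra. lra.
Qed.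

(** The fraction (1 - 2^(-j))^d of volume that survives shrinking is at least 1 - d 2^(-j) by
    Bernoulli. *)
Lemma shrink_factor_ge_half d j :
  2 * INR d <= 2 ^ j -> / 2 <= (2 ^ j - 1) ^ d / 2 ^ (j * d).
Proof.
  intros H. pose proof (pow2_pos j).
  replace ((2 ^ j - 1) ^ d / 2 ^ (j * d)) with ((1 - / 2 ^ j) ^ d).
  - assert (1 <= 2 ^ j) by (apply pow_R1_Rle; lra).
    assert (0 <= / 2 ^ j <= 1).
    { split; [left; now apply Rinv_0_lt_compat|]. rewrite <- Rinv_1. now apply Rinv_le_contravar; [lra|]. }
    apply Rle_trans with (2 := one_minus_pow (/ 2 ^ j) d H2).
    assert (INR d * / 2 ^ j <= / 2); [|lra].
    apply Rmult_le_reg_r with (2 ^ j); auto. rewrite Rmult_assoc, Rinv_l by lra. lra.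
  - rewrite pow_mult. unfold Rdiv. rewrite <- (pow_inv (2 ^ j)), <- Rpow_mult_distr. f_equal. field. lra.
Qed.

Lemma convex_body_bounded d K : convex_body d K ->
  exists M : nat, forall x i, K x -> (i < d)%nat -> Rabs (x i) <= INR M.
Proof.
  intros [(_ & _ & (M & HM)) _]. destruct (INR_unbounded M) as (m & Hm).
  exists m. intros x i Hx Hi. pose proof (Rabs_coord_le_norm d x i Hi). specialize (HM x Hx). lra.
Qed.

(** Shifted by M 2^n, the cube indices are distinct points of a box of side 2 M 2^n. This supplies
    the upper bound from which completeness produces the volume. *)
Lemma cubes_in_bounded d n K l (M : nat) :
  (forall x i, K x -> (i < d)%nat -> Rabs (x i) <= INR M) ->
  cubes_in d n K l -> INR (length l) / 2 ^ (n * d) <= (2 * INR M) ^ d.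
Proof.
  intros HM [Hnd Hl]. pose proof (pow2_pos (n * d)). pose proof (pow2_pos n) as Hn.
  assert (HB : (length l <= (2 * M * 2 ^ n) ^ d)%nat).
  { rewrite <- length_box.
    rewrite <- (length_map (fun z => mkv d (fun i => nth i z 0 + Z.of_nat (M * 2 ^ n))%Z) l).
    apply NoDup_incl_length.
    - apply NoDup_map_NoDup_ForallPairs; auto. intros u v Hu Hv E.
      apply vec_ext with d; [apply Hl; auto|apply Hl; auto|]. intros i Hi.
      apply (f_equal (fun w => nth i w 0%Z)) in E. rewrite !nth_mkv in E by auto. lia.
    - intros w Hw. apply in_map_iff in Hw. destruct Hw as (z & <- & Hz).
      apply in_box. split; [apply length_mkv|]. intros i Hi. rewrite nth_mkv by auto.
      destruct (Hl z Hz) as [_ HK].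
      assert (H1 : - INR M * 2 ^ n <= IZR (nth i z 0%Z)).
      { specialize (HM _ i (HK _ (dcube_gridpt d n z)) Hi). rewrite gridpt_lt in HM by auto.
        apply Rabs_le_both in HM. destruct HM as [HM _].
        apply Rmult_le_compat_r with (r := 2 ^ n) in HM; [|lra].
        unfold Rdiv in HM. rewrite (Rmult_assoc (IZR _)), Rinv_l in HM by lra. lra. }
      assert (H2 : IZR (nth i z 0%Z) + 1 <= INR M * 2 ^ n).
      (* The opposite corner of the cube: the lowest corner alone would only bound the index, not
         the index plus one. *)
      { set (x := fun i => if Nat.ltb i d then (IZR (nth i z 0%Z) + 1) / 2 ^ n else 0).
        assert (Hx : dcube d n z x).
        { apply dcube_iff_scaled. split.
          - intros t Ht. unfold x. apply Nat.ltb_ge in Ht. now rewrite Ht.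
          - intros t Ht. unfold x. apply Nat.ltb_lt in Ht. rewrite Ht.
            unfold Rdiv. rewrite Rmult_assoc, Rinv_l by lra. lra. }
        specialize (HM _ i (HK _ Hx) Hi). unfold x in HM. pose proof Hi as Hi'.
        apply Nat.ltb_lt in Hi'. rewrite Hi' in HM.
        apply Rabs_le_both in HM. destruct HM as [_ HM].
        apply Rmult_le_compat_r with (r := 2 ^ n) in HM; [|lra].
        unfold Rdiv in HM. rewrite (Rmult_assoc (_ + _)), Rinv_l in HM by lra. lra. }
      assert (HE : INR M * 2 ^ n = IZR (Z.of_nat (M * 2 ^ n))).
      { rewrite <- INR_IZR_INZ, mult_INR, pow_INR. now replace (INR 2) with 2 by (simpl; lra). }
      rewrite Ropp_mult_distr_l_reverse in H1. rewrite HE in H1, H2. rewrite <- opp_IZR in H1. apply le_IZR in H1.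
      rewrite <- plus_IZR in H2. apply le_IZR in H2. lia. }
  apply le_INR in HB. rewrite pow_INR, !mult_INR, pow_INR in HB. replace (INR 2) with 2 in HB by (simpl; lra).
  rewrite Rpow_mult_distr, <- pow_mult in HB.
  apply Rmult_le_reg_r with (2 ^ (n * d)); auto. unfold Rdiv.
  rewrite Rmult_assoc, Rinv_l by lra. lra.
Qed.

Lemma floor_vec d (x : nat -> R) (c : R) :
  exists z, length z = d /\ forall i, (i < d)%nat -> IZR (nth i z 0%Z) <= x i * c <= IZR (nth i z 0%Z) + 1.
Proof.
  exists (mkv d (fun i => Int_part (x i * c))). split; [apply length_mkv|].
  intros i Hi. rewrite nth_mkv by auto. pose proof (base_Int_part (x i * c)). lra.
Qed.

(** Choose [n] with d <= e 2^n. In positive dimension the dyadic cube around the centre [a] then has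
    diameter at most sqrt(d) / 2^n <= e. *)
Lemma interior_cube d K : nonempty_interior d K ->
  exists n z, length z = d /\ forall x, dcube d n z x -> K x.
Proof.
  intros (a & e & Ha & He & HK).
  destruct (INR_unbounded (INR d / e)) as (n & Hn).
  assert (Hde : INR d <= e * 2 ^ n).
  { pose proof (pow2_ge_INR n). apply Rmult_le_reg_r with (/ e); [now apply Rinv_0_lt_compat|].
    replace (e * 2 ^ n * / e) with (2 ^ n) by (field; lra). unfold Rdiv in Hn. lra. }
  destruct (floor_vec d a (2 ^ n)) as (z & Hz & Hza).
  exists n, z. split; auto. intros x Hx. apply HK.
  apply dcube_iff_scaled in Hx. destruct Hx as [Hx0 Hx]. split; auto.
  pose proof (pow2_pos n) as Hp. pose proof (pos_INR d) as Hd.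
  apply norm_le_sqr; [lra|].
  apply Rle_trans with (sumR d (fun _ => 0 * 0 + (/ 2 ^ n) * (/ 2 ^ n))).
  - apply sumR_le. intros i Hi. unfold vsub. specialize (Hx i Hi). specialize (Hza i Hi).
    assert (Hq : 0 < / 2 ^ n) by now apply Rinv_0_lt_compat.
    replace (x i - a i) with ((x i * 2 ^ n - a i * 2 ^ n) * / 2 ^ n) by (field; lra).
    set (u := x i * 2 ^ n - a i * 2 ^ n).
    assert (u * u <= 1) by (assert (-1 <= u <= 1) by (unfold u; lra); nra).
    assert (0 < / 2 ^ n * / 2 ^ n) by (apply Rmult_lt_0_compat; auto). nra.
  - rewrite (sumR_affine d (fun _ => 0) 0). rewrite Rmult_0_l, Rplus_0_l.
    apply Rmult_le_reg_r with (2 ^ n * 2 ^ n); [nra|].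
    replace (INR d * (/ 2 ^ n * / 2 ^ n) * (2 ^ n * 2 ^ n)) with (INR d) by (field; lra).
    destruct d as [|d]; [simpl; nra|].
    assert (1 <= INR (S d)) by (rewrite S_INR; pose proof (pos_INR d); lra). nra.
Qed.

Lemma convex_body_vol d K : convex_body d K -> exists v, is_vol d K v /\ 0 < v.
Proof.
  intros HK. destruct (convex_body_bounded d K HK) as (M & HM).
  destruct (interior_cube d K (proj2 (proj2 HK))) as (n & z & Hz & Hcube).
  assert (H1 : cubes_in d n K [z]).
  { split; [repeat constructor; intros []|]. intros y [<-|[]]. auto. }
  edestruct completeness as (v & Hv); [| |exists v; split; [exact Hv|]].
  - exists ((2 * INR M) ^ d). intros a (n' & l & Hnd & Hl & ->).
    apply cubes_in_bounded with K; auto. split; auto.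
  - eexists. exists n, [z]. split; [apply H1|]. split; [apply H1|reflexivity].
  - apply Rlt_le_trans with (2 := vol_ge_cubes _ _ _ _ _ Hv H1). simpl.
    unfold Rdiv. rewrite Rmult_1_l. apply Rinv_0_lt_compat, pow2_pos.
Qed.

(** Preimages of distinct positions are distinct, so choosing one for each creates no repetition.
    This passes from offsets modulo the period to indices of the infinite arrangement. *)
Lemma lift_positions (g : nat -> nat) (Q : nat -> Prop) (pos : list nat) :
  NoDup pos -> (forall q, In q pos -> exists i, g i = q /\ Q i) ->
  exists l, NoDup l /\ length l = length pos /\ forall i, In i l -> Q i /\ In (g i) pos.
Proof.
  intros Hnd. induction Hnd as [|q pos Hq Hnd IH]; intros H.
  - exists []. split; [constructor|]. split; [reflexivity|intros i []].
  - destruct IH as (l & H1 & H2 & H3). { intros; apply H; now right. }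
    destruct (H q (or_introl eq_refl)) as (i & <- & Hi).
    exists (i :: l). split.
    + constructor; auto. intros Hil. apply Hq. now apply H3.
    + split; [simpl; congruence|]. intros i' [<-|Hi']; [split; auto; now left|].
      split; [now apply H3|right; now apply H3].
Qed.

Lemma finite_bound (f : nat -> R) (a : nat) : exists W, 0 <= W /\ forall i, (i < a)%nat -> Rabs (f i) <= W.
Proof.
  induction a as [|a (W & H0 & HW)]; [exists 0; split; [lra|lia]|].
  pose proof (Rabs_pos (f a)). exists (W + Rabs (f a)). split; [lra|]. intros i Hi.
  destruct (Nat.eq_dec i a) as [->|]; [lra|]. specialize (HW i ltac:(lia)). lra.
Qed.

Lemma finite_bound2 (f : nat -> nat -> R) (a b : nat) :
  exists W, 0 <= W /\ forall q i, (q < a)%nat -> (i < b)%nat -> Rabs (f q i) <= W.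
Proof.
  induction a as [|a (W & H0 & HW)]; [exists 0; split; [lra|lia]|].
  destruct (finite_bound (f a) b) as (W' & H0' & HW').
  exists (W + W'). split; [lra|]. intros q i Hq Hi.
  destruct (Nat.eq_dec q a) as [->|].
  - specialize (HW' i Hi). lra.
  - specialize (HW q i ltac:(lia) Hi). lra.
Qed.

(** * Periodic arrangements *)

(* [vdec] enumerates the lattice of periods, whose mesh is [M / 2 ^ n]. *)
Definition periodic (e n M m : nat) (off : nat -> nat -> R) (i : nat) : nat -> R :=
  fun t => off (i mod m)%nat t + INR M * gridpt (S e) n (vdec e (i / m)) t.

Lemma periodic_covering e n M m off k K :
  (0 < m)%nat -> (forall q, inRd (S e) (off q)) ->
  (forall x, inRd (S e) x -> exists pos, NoDup pos /\ length pos = k /\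
     forall q, In q pos -> (q < m)%nat /\ exists v, length v = S e /\
       K (fun t => x t - (off q t + INR M * gridpt (S e) n v t))) ->
  kfold_covering (S e) k K (periodic e n M m off).
Proof.
  intros Hm Hoff H. split.
  - intros i t Ht. unfold periodic. rewrite Hoff, gridpt_inRd by auto. ring.
  - intros x Hx. destruct (H x Hx) as (pos & Hnd & Hk & Hpos).
    destruct (lift_positions (fun i => (i mod m)%nat)
      (fun i => K (vsub x (periodic e n M m off i))) pos Hnd) as (l & H1 & H2 & H3).
    + intros q Hq. destruct (Hpos q Hq) as (Hqm & v & Hv & HKv).
      destruct (vdec_surj e v Hv) as (c & <-).
      (* The index with remainder [q], which selects the offset, and quotient [c], which selects the
         period vector. *)
      exists (q + c * m)%nat. rewrite Nat.Div0.mod_add, Nat.mod_small by auto.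
      split; auto. unfold vsub, periodic.
      rewrite Nat.Div0.mod_add, Nat.mod_small, Nat.div_add, Nat.div_small by lia. exact HKv.
    + exists l. split; auto. split; [congruence|]. intros i Hi. now apply H3.
Qed.

(** Period vector and remainder together determine the index, so each period vector accounts for at
    most [m] indices. *)
Lemma periodic_index_count e m (l : list nat) :
  (0 < m)%nat -> NoDup l ->
  (length l <= length (nodup vec_dec (map (fun i => vdec e (i / m)) l)) * m)%nat.
Proof.
  intros Hm Hl. set (V := nodup _ _).
  replace (length V * m)%nat with (length (list_prod V (seq 0 m)))
    by now rewrite length_prod, length_seq.
  rewrite <- (length_map (fun i => (vdec e (i / m), (i mod m)%nat)) l).
  apply NoDup_incl_length.
  - apply NoDup_map_NoDup_ForallPairs; auto. intros i i' _ _ E. inversion E as [[E1 E2]].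
    apply vdec_inj in E1. rewrite (Nat.div_mod i m), (Nat.div_mod i' m) by lia. congruence.
  - intros p Hp. apply in_map_iff in Hp. destruct Hp as (i & <- & Hi).
    apply in_prod_iff. split.
    + apply nodup_In. apply in_map_iff. eauto.
    + apply in_seq. pose proof (Nat.mod_upper_bound i m). lia.
Qed.

(* AM-GM on the cross term; this replaces the triangle inequality of the norm. *)
Lemma shrink_sqr (q f b W : R) :
  1 <= q -> Rabs b <= W ->
  ((q - 1) / q * (f + b)) * ((q - 1) / q * (f + b)) <= (1 - / q) * (f * f) + (1 + q) * (W * W).
Proof.
  intros Hq Hb. set (D := / q).
  assert (HD : 0 < D <= 1).
  { unfold D. split; [apply Rinv_0_lt_compat; lra|]. rewrite <- Rinv_1. apply Rinv_le_contravar; lra. }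
  assert (HqD : q * D = 1) by (unfold D; field; lra).
  replace ((q - 1) / q) with (1 - D) by (unfold D; field; lra).
  assert (HbW : b * b <= W * W) by (apply Rabs_le_both in Hb; nra).
  assert (H1 : (f + b) * (f + b) <= (1 + D) * (f * f) + (1 + q) * (b * b)).
  { assert (0 <= q * ((D * f - b) * (D * f - b))).
    { apply Rmult_le_pos; [lra|apply sqr_nonneg]. }
    assert (E : q * ((D * f - b) * (D * f - b)) = (q * D) * D * (f * f) - 2 * (q * D) * f * b + q * (b * b)) by ring.
    rewrite HqD in E. nra. }
  apply Rle_trans with ((1 - D) * (1 - D) * ((1 + D) * (f * f) + (1 + q) * (b * b))).
  - replace ((1 - D) * (f + b) * ((1 - D) * (f + b))) with ((1 - D) * (1 - D) * ((f + b) * (f + b))) by ring.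
    apply Rmult_le_compat_l; [apply sqr_nonneg|exact H1].
  - assert (Hs : 0 <= (1 - D) * (1 - D) <= 1) by (split; [apply sqr_nonneg|nra]).
    assert (H2 : (1 - D) * (1 - D) * (1 + D) <= 1 - D) by nra.
    pose proof (sqr_nonneg f). pose proof (sqr_nonneg b).
    assert ((1 - D) * (1 - D) * (1 + D) * (f * f) <= (1 - D) * (f * f))
      by (apply Rmult_le_compat_r; auto).
    assert (0 <= (1 + q) * (b * b)) by (apply Rmult_le_pos; lra).
    assert ((1 - D) * (1 - D) * ((1 + q) * (b * b)) <= (1 + q) * (b * b)) by nra.
    assert ((1 + q) * (b * b) <= (1 + q) * (W * W)) by (apply Rmult_le_compat_l; lra).
    lra.
Qed.

(** Every translate inside the ball has a period cell at bounded distance from it. Shrunk by 1 -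
    2^(-j) about the origin, these cells lie in the ball once [r] is large and keep half of their
    volume, which explains the factor 2 in the hypothesis on [D]. *)
Lemma periodic_density e n M m off K p j D :
  (0 < M)%nat -> (0 < m)%nat -> (1 <= j)%nat -> 2 * INR (S e) <= 2 ^ j -> K p -> inRd (S e) p ->
  (forall vK, is_vol (S e) K vK -> 2 * INR m * vK * 2 ^ (n * S e) / INR M ^ S e <= D) ->
  density_le (S e) K (periodic e n M m off) D.
Proof.
  set (d := S e). intros HM Hm Hj Hdj Hp Hp0 HD.
  destruct (finite_bound p d) as (Wp & HWp0 & HWp).
  destruct (finite_bound2 off m d) as (Wo & HWo0 & HWo).
  assert (HMr : 0 < INR M) by now apply lt_0_INR.
  assert (Hmr : 0 < INR m) by now apply lt_0_INR.
  pose proof (pow2_pos n) as Hn. pose proof (pow2_pos j) as Hj0.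
  (* Coordinatewise bound on the distance from a point of the cell to the point [p] of the
     translate: size of [p], size of the offset, side of the cell. *)
  set (W := Wp + Wo + INR M / 2 ^ n).
  assert (HW : 0 <= INR M / 2 ^ n).
  { apply Rmult_le_pos; [lra|]. left. now apply Rinv_0_lt_compat. }
  assert (Hq : 2 <= 2 ^ j).
  { replace 2 with (2 ^ 1) at 1 by ring. apply Rle_pow; [lra|auto]. }
  set (C := INR d * ((1 + 2 ^ j) * (W * W))).
  assert (HC : 0 <= C).
  { apply Rmult_le_pos; [apply pos_INR|]. apply Rmult_le_pos; [lra|apply sqr_nonneg]. }
  (* Then r^2 >= 2^j C, so the gain 2^(-j) r^2 from shrinking pays for the error [C]. *)
  intros eps Heps. exists (1 + 2 ^ j * C). intros r Hr vK vB HvK HvB l Hnd Hl.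
  assert (HvK0 := vol_nonneg _ _ _ HvK). specialize (HD vK HvK).
  assert (HMd : 0 < INR M ^ d) by now apply pow_lt.
  assert (HD0 : 0 <= D).
  { apply Rle_trans with (2 := HD). apply Rmult_le_pos.
    - pose proof (pow2_pos (n * d)). repeat apply Rmult_le_pos; lra.
    - left. now apply Rinv_0_lt_compat. }
  (* A nonempty [l] is what later yields a cell in the ball and hence [vB > 0]. *)
  destruct (list_eq_dec Nat.eq_dec l []) as [->|Hne].
  { simpl. unfold Rdiv. rewrite Rmult_0_r, Rmult_0_l. lra. }
  pose proof (periodic_index_count e m l Hm Hnd) as Hcount.
  set (V := nodup vec_dec (map (fun i => vdec e (i / m)) l)) in *.
  assert (HVin : forall v, In v V -> exists i, In i l /\ v = vdec e (i / m)).
  { intros v Hv. apply nodup_In, in_map_iff in Hv. destruct Hv as (i & <- & Hi). eauto. }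
  assert (HVd : forall v, In v V -> length v = d).
  { intros v Hv. destruct (HVin v Hv) as (i & _ & ->). apply length_vdec. }
  assert (Hcubes : cubes_in d (n + j) (rB d r) (subdiv d (2 ^ j - 1) (subdiv d M V))).
  { split.
    - apply NoDup_subdiv; [apply NoDup_subdiv; auto; apply NoDup_nodup|].
      intros z Hz. now apply in_subdiv in Hz.
    - intros z Hz. split; [now apply in_subdiv in Hz|]. intros x Hx.
      assert (Hx0 : inRd d x) by apply Hx.
      destruct (dcube_shrink d n j _ z x Hj Hz Hx) as (y & Hy & Hyx).
      apply in_subdiv in Hy. destruct Hy as (_ & v & Hv & Hyv).
      destruct (HVin v Hv) as (i & Hi & ->).
      specialize (Hl i Hi p Hp). destruct Hl as [_ Hl].
      set (f := vsub (vadd p (periodic e n M m off i)) (fun _ => 0)) in Hl.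
      assert (Hr0 : 1 <= r) by nra.
      apply norm_le_sqr in Hl; [|lra]. split; auto. apply norm_le_sqr; [lra|].
      apply Rle_trans with (sumR d (fun t => (1 - / 2 ^ j) * (f t * f t) + (1 + 2 ^ j) * (W * W))).
      + apply sumR_le. intros t Ht. unfold vsub at 1 2. rewrite Rminus_0_r.
        set (g := scale (2 ^ j / (2 ^ j - 1)) x t).
        assert (Hg : x t = (2 ^ j - 1) / 2 ^ j * (f t + (g - f t))).
        { unfold g, scale. field. lra. }
        rewrite Hg. apply shrink_sqr; [lra|].
        destruct Hyx as [_ Hyx]. specialize (Hyx t Ht). fold g in Hyx.
        specialize (Hyv t Ht). apply IZR_cube_bounds in Hyv. rewrite <- INR_IZR_INZ in Hyv.
        unfold f, vsub, vadd, periodic. rewrite gridpt_lt by auto.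
        specialize (HWp t Ht). specialize (HWo (i mod m)%nat t).
        specialize (HWo ltac:(apply Nat.mod_upper_bound; lia) Ht).
        apply Rabs_le_both in HWp, HWo.
        set (vt := IZR (nth t (vdec e (i / m)) 0%Z)) in *. set (yt := IZR (nth t y 0%Z)) in *.
        assert (Hi2 : 0 < / 2 ^ n) by now apply Rinv_0_lt_compat.
        assert (INR M * (vt / 2 ^ n) <= yt / 2 ^ n).
        { unfold Rdiv. rewrite <- Rmult_assoc. apply Rmult_le_compat_r; lra. }
        assert ((yt + 1) / 2 ^ n <= INR M * (vt / 2 ^ n) + INR M / 2 ^ n).
        { replace (INR M * (vt / 2 ^ n) + INR M / 2 ^ n) with ((INR M * (vt + 1)) / 2 ^ n) by (field; lra).
          unfold Rdiv. apply Rmult_le_compat_r; lra. }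
        apply Rabs_le. unfold W. lra.
      + rewrite sumR_affine. fold C.
        assert (Hij : 0 < / 2 ^ j) by now apply Rinv_0_lt_compat.
        assert (HiE : / 2 ^ j * 2 ^ j = 1) by (field; lra).
        assert (Hle1 : / 2 ^ j <= 1) by nra.
        apply Rle_trans with ((1 - / 2 ^ j) * (r * r) + C).
        * apply Rplus_le_compat_r, Rmult_le_compat_l; lra.
        * assert (C * 1 <= / 2 ^ j * (r * r)); [|lra].
          rewrite <- HiE. replace (C * (/ 2 ^ j * 2 ^ j)) with (/ 2 ^ j * (2 ^ j * C)) by ring.
          apply Rmult_le_compat_l; [lra|]. nra. }
  apply (vol_ge_cubes _ _ _ _ _ HvB) in Hcubes.
  rewrite !length_subdiv, !mult_INR, !pow_INR, INR_pow_sub1 in Hcubes.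
  pose proof (shrink_factor_ge_half d j Hdj) as Hhalf.
  assert (HV1 : 1 <= INR (length V)).
  { apply (le_INR 1). destruct V; [|simpl; lia]. simpl in Hcount. destruct l; [congruence|simpl in Hcount; lia]. }
  assert (HB : INR (length V) * INR M ^ d / 2 ^ (n * d) * / 2 <= vB).
  { apply Rle_trans with (2 := Hcubes).
    rewrite Nat.mul_add_distr_r, pow_add.
    pose proof (pow2_pos (n * d)). pose proof (pow2_pos (j * d)).
    replace (INR (length V) * INR M ^ d * (2 ^ j - 1) ^ d / (2 ^ (n * d) * 2 ^ (j * d)))
      with (INR (length V) * INR M ^ d / 2 ^ (n * d) * ((2 ^ j - 1) ^ d / 2 ^ (j * d))) by (field; lra).
    apply Rmult_le_compat_l; auto. apply Rmult_le_pos; [nra|]. left. now apply Rinv_0_lt_compat. }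
  apply le_INR in Hcount. rewrite mult_INR in Hcount.
  pose proof (pow2_pos (n * d)) as Hnd0.
  assert (HX : 0 < INR (length V) * INR M ^ d / 2 ^ (n * d) * / 2).
  { apply Rmult_lt_0_compat; [|lra]. unfold Rdiv. apply Rmult_lt_0_compat.
    - apply Rmult_lt_0_compat; lra.
    - now apply Rinv_0_lt_compat. }
  assert (HvB0 : 0 < vB) by lra.
  apply Rle_trans with D; [|lra].
  apply Rmult_le_reg_r with vB; auto. unfold Rdiv. rewrite Rmult_assoc, Rinv_l by lra. rewrite Rmult_1_r.
  apply Rle_trans with (vK * (INR (length V) * INR m)); [apply Rmult_le_compat_l; lra|].
  apply Rle_trans with (D * (INR (length V) * INR M ^ d / 2 ^ (n * d) * / 2)); [|apply Rmult_le_compat_l; lra].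
  apply Rle_trans with ((2 * INR m * vK * 2 ^ (n * d) / INR M ^ d) * (INR (length V) * INR M ^ d / 2 ^ (n * d) * / 2)).
  - right. field. lra.
  - apply Rmult_le_compat_r; lra.
Qed.

(** * From the torus to the covering *)

(** The greedy list may repeat a translate; positions are distinct and so keep the
    multiplicities. *)
Lemma filter_positions {A} (f : A -> bool) (L : list A) (x0 : A) :
  exists pos, NoDup pos /\ length pos = length (filter f L) /\
    forall q, In q pos -> (q < length L)%nat /\ f (nth q L x0) = true.
Proof.
  induction L as [|x L (pos & H1 & H2 & H3)].
  - exists []. split; [constructor|]. split; [reflexivity|intros q []].
  - assert (HS : NoDup (map S pos)).
    { apply NoDup_map_NoDup_ForallPairs; auto. intros a b _ _ E. congruence. }
    assert (HS' : forall q, In q (map S pos) -> (q < length (x :: L))%nat /\ f (nth q (x :: L) x0) = true).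
    { intros q Hq. apply in_map_iff in Hq. destruct Hq as (q' & <- & Hq').
      destruct (H3 q' Hq'). simpl. split; [lia|auto]. }
    simpl filter. destruct (f x) eqn:E.
    + exists (0%nat :: map S pos). split.
      * constructor; auto. intros H. apply in_map_iff in H. destruct H as (? & ? & _). discriminate.
      * split; [simpl; now rewrite length_map, H2|]. intros q [<-|Hq]; auto. simpl. split; [lia|auto].
    + exists (map S pos). split; auto. split; [now rewrite length_map|auto].
Qed.

(** At scale n + 1 the cube a + b consists of the midpoints between points of the cube [a] and the
    lowest corner of the cube [b]. Thus all index sums give cubes in [K] at half the side length. *)
Lemma dcube_midpoint d n K a b x :
  is_convex d K ->
  (forall y, dcube d n a y -> K y) -> (forall y, dcube d n b y -> K y) ->
  dcube d (n + 1) (vecadd d a b) x -> K x.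
Proof.
  intros Hconv Ha Hb Hx. apply dcube_iff_scaled in Hx. destruct Hx as [Hx0 Hx].
  assert (H1 : K (fun i => 2 * x i - gridpt d n b i)).
  { apply Ha. apply dcube_iff_scaled. split.
    - intros i Hi. rewrite Hx0, gridpt_inRd by auto. ring.
    - intros i Hi. specialize (Hx i Hi). unfold vecadd in Hx.
      rewrite nth_mkv, plus_IZR, pow_add in Hx by auto. rewrite gridpt_lt by auto.
      pose proof (pow2_pos n).
      replace ((2 * x i - IZR (nth i b 0%Z) / 2 ^ n) * 2 ^ n)
        with (x i * (2 ^ n * 2 ^ 1) - IZR (nth i b 0%Z)) by (field; lra).
      lra. }
  pose proof (Hconv _ _ (/ 2) H1 (Hb _ (dcube_gridpt d n b)) ltac:(lra)) as H2.
  replace x with (fun i => (1 - / 2) * (2 * x i - gridpt d n b i) + / 2 * gridpt d n b i); auto.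
  apply functional_extensionality. intros i. field.
Qed.

Lemma pow2_ge_2 j : (1 <= j)%nat -> 2 <= 2 ^ j.
Proof. intros Hj. replace 2 with (2 ^ 1) at 1 by ring. apply Rle_pow; [lra|auto]. Qed.

(** Convexity in the form (1 - 2^(-j)) K + 2^(-j) K inside K: the corner of [a] at scale n + j is
    2^(-j) times its corner at scale [n]. *)
Lemma shrunk_plus_corner d n j K l z a x :
  is_convex d K -> (1 <= j)%nat -> cubes_in d n K l ->
  In z (subdiv d (2 ^ j - 1) l) -> In a l -> dcube d (n + j) z x ->
  K (fun i => x i + gridpt d (n + j) a i).
Proof.
  intros Hconv Hj [_ Hl] Hz Ha Hx.
  destruct (dcube_shrink d n j l z x Hj Hz Hx) as (y & Hy & Hyx).
  pose proof (pow2_ge_2 j Hj) as Hq. pose proof (pow2_pos n).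
  assert (Ht : 0 <= / 2 ^ j <= 1).
  { split; [left; apply Rinv_0_lt_compat; lra|]. rewrite <- Rinv_1. apply Rinv_le_contravar; lra. }
  pose proof (Hconv _ _ (/ 2 ^ j) (proj2 (Hl y Hy) _ Hyx) (proj2 (Hl a Ha) _ (dcube_gridpt d n a)) Ht) as H2.
  replace (fun i => x i + gridpt d (n + j) a i) with
    (fun i => (1 - / 2 ^ j) * scale (2 ^ j / (2 ^ j - 1)) x i + / 2 ^ j * gridpt d n a i); auto.
  apply functional_extensionality. intros i. unfold scale, gridpt.
  destruct (Nat.ltb i d); [rewrite pow_add|]; field; lra.
Qed.

(** The point [x] is 2/2^j times a point of the cube a + b at scale n + 1, which lies in [K]; adding
    the complementary multiple of [p] gives a convex combination. *)
Lemma sum_cube_toward d n j K a b x p :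
  is_convex d K -> (1 <= j)%nat -> K p ->
  (forall y, dcube d n a y -> K y) -> (forall y, dcube d n b y -> K y) ->
  dcube d (n + j) (vecadd d a b) x -> K (fun i => x i + (1 - 2 / 2 ^ j) * p i).
Proof.
  intros Hconv Hj Hp Ha Hb Hx.
  pose proof (pow2_ge_2 j Hj) as Hq. pose proof (pow2_pos n).
  assert (H1 : K (scale (2 ^ j / 2) x)).
  { apply dcube_midpoint with d n a b; auto. apply dcube_iff_scaled in Hx. apply dcube_iff_scaled.
    destruct Hx as [Hx0 Hx]. unfold scale. split.
    - intros i Hi. rewrite Hx0 by auto. ring.
    - intros i Hi. specialize (Hx i Hi). rewrite pow_add in *.
      replace (2 ^ j / 2 * x i * (2 ^ n * 2 ^ 1)) with (x i * (2 ^ n * 2 ^ j)) by field. exact Hx. }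
  assert (Ht : 0 <= 2 / 2 ^ j <= 1).
  { assert (0 < / 2 ^ j) by (apply Rinv_0_lt_compat; lra).
    assert (/ 2 ^ j <= / 2) by (apply Rinv_le_contravar; lra). lra. }
  pose proof (Hconv _ _ (2 / 2 ^ j) Hp H1 Ht) as H2.
  replace (fun i => x i + (1 - 2 / 2 ^ j) * p i) with
    (fun i => (1 - 2 / 2 ^ j) * p i + 2 / 2 ^ j * scale (2 ^ j / 2) x i); auto.
  apply functional_extensionality. intros i. unfold scale. field. lra.
Qed.

(* Offsets [q < length L] are the greedily chosen translates; each packing point of [X] gets [k] further
   translates, all placed so as to swallow the difference set of the neighbourhoods. *)
Definition offset (d n j k : nat) (L X : list (list Z)) (s : list Z) (p : nat -> R) (q : nat) : nat -> R :=
  if Nat.ltb q (length L) then gridpt d (n + j) (nth q L [])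
  else fun i => gridpt d (n + j) (vecsub d (nth ((q - length L) / k) X []) s) i - (1 - 2 / 2 ^ j) * p i.

Lemma offset_inRd d n j k L X s p q : inRd d p -> inRd d (offset d n j k L X s p q).
Proof.
  intros Hp i Hi. unfold offset. destruct (Nat.ltb q (length L)).
  - now apply gridpt_inRd.
  - rewrite gridpt_inRd, Hp by auto. ring.
Qed.

(** Locate [x] in a grid cube and reduce its index to [x1] modulo [M]. If some y = x1 - a is covered
    [k] times by shrunken bodies, adding [a] back stays inside the full bodies. Otherwise x1 - x' =
    a - a' = (a + b) - s with b = s - a' in [l], so [x] lies in all [k] bodies attached to [x']. *)
Lemma torus_covering d n j k M K l Sp s L X p :
  is_convex d K -> (1 <= j)%nat -> (1 <= k)%nat -> (0 < M)%nat -> cubes_in d n K l -> K p -> inRd d p ->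
  incl Sp l -> (forall a, In a Sp -> In (vecsub d s a) l) ->
  (forall x, In x (box d M) ->
     (exists y, In y (box d M) /\ modrel d M Sp x y = true /\
        (k <= cover_count (fun t y => modrel d M (subdiv d (2 ^ j - 1) l) y t) L y)%nat) \/
     (exists x' y, In x' X /\ In y (box d M) /\
        modrel d M Sp x y = true /\ modrel d M Sp x' y = true)) ->
  forall x, inRd d x -> exists pos, NoDup pos /\ length pos = k /\
    forall q, In q pos -> (q < length L + k * length X)%nat /\ exists v, length v = d /\
      K (fun t => x t - (offset d n j k L X s p q t + INR M * gridpt d (n + j) v t)).
Proof.
  intros Hconv Hj Hk HM Hl Hp Hp0 HSp Hs Hcov x Hx0.
  destruct (floor_vec d x (2 ^ (n + j))) as (z0 & Hz0 & Hfl).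
  pose proof (pow2_pos (n + j)) as Hpos.
  set (x1 := mkv d (fun i => nth i z0 0 mod Z.of_nat M)%Z).
  set (v0 := fun i => (nth i z0 0 / Z.of_nat M)%Z).
  assert (Hx1 : In x1 (box d M)).
  { apply in_box. split; [apply length_mkv|]. intros i Hi. unfold x1. rewrite nth_mkv by auto.
    apply Z.mod_pos_bound. lia. }
  assert (Hz0E : forall i, (i < d)%nat -> (nth i z0 0 = nth i x1 0 + Z.of_nat M * v0 i)%Z).
  { intros i Hi. unfold x1, v0. rewrite nth_mkv by auto.
    pose proof (Z.div_mod (nth i z0 0)%Z (Z.of_nat M) ltac:(lia)). lia. }
  destruct (Hcov x1 Hx1) as [(y & Hy & Hxy & Hcnt)|(x' & y & Hx' & Hy & Hxy & Hx'y)].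
  - destruct (filter_positions (fun t => modrel d M (subdiv d (2 ^ j - 1) l) y t) L [])
      as (pos & Hnd & Hlen & Hpos').
    exists (firstn k pos).
    rewrite <- (firstn_skipn k pos) in Hnd. split; [now apply NoDup_app_remove_r in Hnd|].
    split; [apply firstn_length_le; unfold cover_count in Hcnt; lia|].
    intros q Hq. destruct (Hpos' q) as (HqL & Ht).
    { rewrite <- (firstn_skipn k pos). apply in_or_app. now left. }
    split; [lia|]. unfold offset. apply Nat.ltb_lt in HqL. rewrite HqL.
    set (t := nth q L []) in *.
    apply modrel_spec in Hxy, Ht; auto.
    destruct Hxy as (a & v1 & Ha & Hv1 & E1), Ht as (z & v2 & Hz & Hv2 & E2).
    (* Collects the wrap-arounds of the three reductions modulo [M]. *)
    set (v := mkv d (fun i => v0 i + nth i v1 0 + nth i v2 0)%Z).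
    exists v. split; [apply length_mkv|].
    pose proof (shrunk_plus_corner d n j K l z a
      (fun i => x i - gridpt d (n + j) t i - INR M * gridpt d (n + j) v i - gridpt d (n + j) a i)
      Hconv Hj Hl Hz (HSp a Ha)) as HK.
    replace (fun t0 => x t0 - _) with (fun i => x i - gridpt d (n + j) t i
       - INR M * gridpt d (n + j) v i - gridpt d (n + j) a i + gridpt d (n + j) a i)
      by (apply functional_extensionality; intros i; ring).
    apply HK. apply dcube_iff_scaled. split.
    + intros i Hi. rewrite Hx0, !gridpt_inRd by auto. ring.
    + intros i Hi. specialize (Hfl i Hi). rewrite !gridpt_lt by auto.
      assert (E : (nth i z0 0 = nth i t 0 + nth i z 0 + nth i a 0 + Z.of_nat M * nth i v 0)%Z).
      { unfold v. rewrite nth_mkv by auto. rewrite Hz0E, (E1 i), (E2 i) by auto. ring. }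
      rewrite E, !plus_IZR, mult_IZR, <- INR_IZR_INZ in Hfl.
      set (H := 2 ^ (n + j)) in *.
      match goal with |- _ <= ?e <= _ =>
        replace e with (x i * H - IZR (nth i t 0%Z) - INR M * IZR (nth i v 0%Z) - IZR (nth i a 0%Z))
          by (field; lra) end.
      lra.
  - destruct (In_nth X x' [] Hx') as (r & Hr & Er).
    (* The block of [k] consecutive indices that [offset] assigns to the [r]-th point of [X]. *)
    exists (seq (length L + k * r) k). split; [apply seq_NoDup|]. split; [apply length_seq|].
    intros q Hq. apply in_seq in Hq.
    assert (HqL : Nat.ltb q (length L) = false) by (apply Nat.ltb_ge; lia).
    assert (Hqr : ((q - length L) / k = r)%nat).
    { symmetry. apply Nat.div_unique with (q - length L - k * r)%nat; lia. }
    split; [nia|]. unfold offset. rewrite HqL, Hqr, Er.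
    apply modrel_spec in Hxy, Hx'y; auto.
    destruct Hxy as (a & v1 & Ha & Hv1 & E1), Hx'y as (a' & v2 & Ha' & Hv2 & E2).
    set (v := mkv d (fun i => v0 i + nth i v1 0 - nth i v2 0)%Z).
    exists v. split; [apply length_mkv|].
    set (b := vecsub d s a').
    pose proof (sum_cube_toward d n j K a b
      (fun i => x i - gridpt d (n + j) (vecsub d x' s) i - INR M * gridpt d (n + j) v i) p
      Hconv Hj Hp (proj2 (proj2 Hl a (HSp a Ha))) (proj2 (proj2 Hl b (Hs a' Ha')))) as HK.
    replace (fun t0 => x t0 - _) with (fun i => x i - gridpt d (n + j) (vecsub d x' s) i
       - INR M * gridpt d (n + j) v i + (1 - 2 / 2 ^ j) * p i)
      by (apply functional_extensionality; intros i; ring).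
    apply HK. apply dcube_iff_scaled. split.
    + intros i Hi. rewrite Hx0, !gridpt_inRd by auto. ring.
    + intros i Hi. specialize (Hfl i Hi). rewrite !gridpt_lt by auto.
      assert (E : (nth i z0 0 = nth i (vecadd d a b) 0 + nth i (vecsub d x' s) 0 + Z.of_nat M * nth i v 0)%Z).
      { unfold v, b, vecadd, vecsub. rewrite !nth_mkv by auto.
        rewrite Hz0E, (E1 i), (E2 i) by auto. ring. }
      rewrite E, !plus_IZR, mult_IZR, <- INR_IZR_INZ in Hfl.
      set (H := 2 ^ (n + j)) in *.
      match goal with |- _ <= ?e <= _ =>
        replace e with (x i * H - IZR (nth i (vecsub d x' s) 0%Z) - INR M * IZR (nth i v 0%Z))
          by (field; lra) end.
      lra.
Qed.

(** * Density estimates *)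

(** The lower bound on 2^j makes shrinking by 1 - 2^(-j) keep half the volume; the upper bound
    limits the loss from scaling by 2^(-j) to (4d)^d. *)
Lemma dyadic_between d : (1 <= d)%nat ->
  exists j, (1 <= j)%nat /\ 2 * INR d <= 2 ^ j <= 4 * INR d.
Proof.
  intros Hd.
  assert (H : exists j, (1 <= j /\ 2 * d <= 2 ^ j <= 4 * d)%nat).
  { induction Hd as [|d Hd (j & Hj & H)]; [exists 1%nat; simpl; lia|].
    destruct (le_lt_dec (2 * S d) (2 ^ j)).
    - exists j. lia.
    - exists (S j). rewrite Nat.pow_succ_r'. lia. }
  destruct H as (j & Hj & H1 & H2). exists j. split; auto.
  apply le_INR in H1, H2. rewrite mult_INR, pow_INR in H1, H2.
  replace (INR 2) with 2 in * by (simpl; lra). replace (INR 4) with 4 in * by (simpl; lra). lra.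
Qed.

Lemma exp1_ge : 9 / 4 <= exp 1.
Proof.
  replace 1 with (/ 2 + / 2) by field. rewrite exp_plus.
  pose proof (exp_ineq1_le (/ 2)). nra.
Qed.

Lemma exp_INR n : exp (INR n) = exp 1 ^ n.
Proof.
  induction n as [|n IH]; [apply exp_0|]. rewrite S_INR, exp_plus, IH. simpl. ring.
Qed.

Lemma pow_one_minus_le_exp x m : 0 <= x <= 1 -> (1 - x) ^ m <= exp (- (INR m * x)).
Proof.
  intros Hx. replace (- (INR m * x)) with (INR m * (- x)) by ring.
  assert (E : exp (INR m * - x) = exp (- x) ^ m).
  { induction m as [|m IH]; [simpl; now rewrite Rmult_0_l, exp_0|].
    rewrite S_INR. simpl. rewrite <- IH, <- exp_plus. f_equal. ring. }
  rewrite E. apply pow_incr. pose proof (exp_ineq1_le (- x)). lra.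
Qed.

Lemma ln_2_le_1 : ln 2 <= 1.
Proof.
  pose proof exp1_ge. rewrite <- (ln_exp 1). left. apply ln_increasing; lra.
Qed.

(** Since ln(8d) <= 3 + ln d, the left side is at most d (34 ln d + 18 ln ln d + 48) + 40. With e >=
    9/4 the right side is at least d (40.5 ln d + 13.5 ln ln d + 202.5), and ln ln d <= ln d absorbs
    the difference. *)
Lemma covering_bound d k :
  (2 <= d)%nat -> (1 <= k)%nat ->
  INR k <= INR d * (ln (INR d) + ln (ln (INR d))) ->
  18 * INR k + 16 * (INR d * ln (8 * INR d)) + 40
    <= 6 * exp 1 * INR d * (3 * ln (INR d) + ln (ln (INR d)) + 15).
Proof.
  intros Hd Hk Hkd.
  assert (HD : 2 <= INR d) by (apply (le_INR 2); lia).
  assert (HK : 1 <= INR k) by (apply (le_INR 1); lia).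
  set (D := INR d) in *. set (Ld := ln D) in *.
  assert (HL : 0 < Ld) by (unfold Ld; rewrite <- ln_1; apply ln_increasing; lra).
  assert (HLD : ln Ld <= Ld).
  { pose proof (exp_ineq1_le (ln Ld)). rewrite exp_ln in H by auto. lra. }
  set (LL := ln Ld) in *.
  assert (H8 : ln (8 * D) <= 3 + Ld).
  { replace (8 * D) with (2 * (2 * (2 * D))) by ring.
    rewrite !ln_mult by lra. fold Ld. pose proof ln_2_le_1. lra. }
  (* Comes from 1 <= k and the bound on [k]; it keeps the last factor nonnegative although ln ln d
     is negative for d = 2. *)
  assert (HY : 0 < Ld + LL).
  { apply Rmult_lt_reg_l with D; lra. }
  pose proof exp1_ge as He.
  apply Rle_trans with (6 * (9 / 4) * D * (3 * Ld + LL + 15)).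
  - assert (D * ln (8 * D) <= D * (3 + Ld)) by (apply Rmult_le_compat_l; lra).
    assert (D * LL <= D * Ld) by (apply Rmult_le_compat_l; lra).
    nra.
  - apply Rmult_le_compat_r; [lra|]. apply Rmult_le_compat_r; [lra|]. lra.
Qed.

(** The choice of [m] makes the power at most 1 / (e^k F e^2). Here e^k beats 2^k and e^2 beats 4,
    while [F] offsets the small size [b] of a neighbourhood. *)
Lemma packing_bound (k m x : nat) (a b G F : R) :
  0 < a -> a <= G -> 0 < F ->
  2 * (INR k + ln F + 2) * G / a <= INR m ->
  INR x * b <= 2 ^ k * (G * (1 - a / (2 * G)) ^ m) ->
  4 * (INR x * b) * F <= G.
Proof.
  intros Ha HaG HF Hm Hx.
  assert (Hr : 0 <= a / (2 * G) <= 1).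
  { split.
    - apply Rmult_le_pos; [lra|]. left; apply Rinv_0_lt_compat; lra.
    - apply Rmult_le_reg_r with (2 * G); [lra|]. unfold Rdiv. rewrite Rmult_assoc, Rinv_l by lra. lra. }
  assert (He : (1 - a / (2 * G)) ^ m <= exp (- (INR k + ln F + 2))).
  { apply Rle_trans with (1 := pow_one_minus_le_exp _ m Hr).
    assert (Hle : INR k + ln F + 2 <= INR m * (a / (2 * G))).
    { apply Rmult_le_compat_r with (r := a / (2 * G)) in Hm; [|lra].
      replace (2 * (INR k + ln F + 2) * G / a * (a / (2 * G))) with (INR k + ln F + 2) in Hm
        by (field; lra). exact Hm. }
    destruct Hle as [Hlt|<-]; [|lra]. left. apply exp_increasing. lra. }
  rewrite exp_Ropp, !exp_plus, exp_ln, exp_INR in He by auto.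
  pose proof exp1_ge as H1.
  assert (H2 : exp 2 = exp 1 * exp 1) by (rewrite <- exp_plus; f_equal; ring).
  assert (Hk0 : 0 < 2 ^ k) by apply pow2_pos.
  assert (Hkk : 2 ^ k <= exp 1 ^ k) by (apply pow_incr; lra).
  assert (H4 : 4 <= exp 2) by (rewrite H2; nra).
  apply Rle_trans with (4 * (2 ^ k * (G * / (exp 1 ^ k * F * exp 2))) * F).
  - apply Rmult_le_compat_r; [lra|]. apply Rmult_le_compat_l; [lra|].
    apply Rle_trans with (1 := Hx). apply Rmult_le_compat_l; [lra|]. apply Rmult_le_compat_l; lra.
  - replace (4 * (2 ^ k * (G * / (exp 1 ^ k * F * exp 2))) * F)
      with (G * ((4 * 2 ^ k) / (exp 2 * exp 1 ^ k))) by (field; lra).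
    rewrite <- (Rmult_1_r G) at 2. apply Rmult_le_compat_l; [lra|].
    assert (0 < exp 2 * exp 1 ^ k) by (apply Rmult_lt_0_compat; lra).
    apply Rmult_le_reg_r with (exp 2 * exp 1 ^ k); auto.
    unfold Rdiv. rewrite Rmult_assoc, Rinv_l, Rmult_1_r, Rmult_1_l by lra.
    apply Rmult_le_compat; lra.
Qed.

(** The [m] greedy translates have density at most 4 rho + 4 and the [k] copies per packing point at
    most k. The factor 2 of [periodic_density] turns this into 8 rho + 8 + 2k with rho = 2 (k + d
    ln(8d) + 2), which is the stated bound. *)
Lemma theta_le_covering d K k :
  (1 <= d)%nat -> convex_body d K -> (1 <= k)%nat ->
  theta_le d k K (18 * INR k + 16 * (INR d * ln (8 * INR d)) + 40).
Proof.
  intros Hd HK Hk.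
  assert (HD : 1 <= INR d) by (apply (le_INR 1); lia).
  destruct (convex_body_vol d K HK) as (vK & HvK & HvK0).
  destruct HK as [(HKd & _) [Hconv (p & e0 & Hp0 & He0 & Hball)]].
  assert (Hp : K p).
  { apply Hball. split; auto. apply norm_le_sqr; [lra|].
    apply Rle_trans with (sumR d (fun _ => 0 * 0 + 0)).
    - apply sumR_le. intros i _. unfold vsub. right. ring.
    - rewrite (sumR_affine d (fun _ => 0)). nra. }
  destruct (dyadic_between d Hd) as (j & Hj & Hj1 & Hj2).
  destruct (vol_approx d K vK (vK / 2) HvK ltac:(lra)) as (n & l & Hl & Hvl).
  pose proof (pow2_pos (n * d)) as Hnd. pose proof (pow2_pos (j * d)) as Hjd.
  pose proof (pow2_ge_2 j Hj) as Hq.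
  assert (HN : vK * 2 ^ (n * d) < 2 * INR (length l)).
  { apply Rmult_lt_compat_r with (r := 2 ^ (n * d)) in Hvl; auto.
    unfold Rdiv in Hvl. rewrite (Rmult_assoc (INR _)), Rinv_l in Hvl by lra. lra. }
  assert (HN0 : 0 < INR (length l)).
  { assert (0 < vK * 2 ^ (n * d)) by now apply Rmult_lt_0_compat. lra. }
  assert (Hlne : l <> []) by (intros ->; simpl in HN0; lra).
  assert (Hlen : forall z, In z l -> length z = d) by (intros z Hz; apply (proj2 Hl z Hz)).
  destruct (popular_sum d l Hlne (proj1 Hl) Hlen) as (s & Sig & HSnd & HSig & Hpop).
  (* These indices, taken from scale [n], will be read at scale n + j, which shrinks the symmetric
     part by 2^(-j). *)
  set (Sp := filter (fun a => memb (vecsub d s a) l) l) in *.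
  set (A := subdiv d (2 ^ j - 1) l).
  assert (HSigvol : INR (length Sig) <= vK * (2 ^ (n * d) * 2 ^ d)).
  { assert (Hc : cubes_in d (n + 1) K Sig).
    { split; auto. intros z Hz. destruct (HSig z Hz) as (a & b & Ha & Hb & ->).
      split; [apply length_mkv|]. intros x Hx.
      apply (dcube_midpoint d n K a b x Hconv); auto; apply (proj2 Hl); auto. }
    apply (vol_ge_cubes _ _ _ _ _ HvK) in Hc.
    rewrite Nat.mul_add_distr_r, Nat.mul_1_l, pow_add in Hc.
    pose proof (pow2_pos d).
    apply Rmult_le_compat_r with (r := 2 ^ (n * d) * 2 ^ d) in Hc; [|nra].
    unfold Rdiv in Hc. rewrite Rmult_assoc, Rinv_l in Hc by nra. lra. }
  set (b := INR (length Sp)) in *.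
  (* With y = vol K measured in cubes, |l| > y/2 and |Sig| <= 2^d y turn |l|^2 <= |Sig| b into y <=
     4 2^d b. *)
  assert (HF2 : vK * 2 ^ (n * d) <= 4 * 2 ^ d * b).
  { pose proof (pow2_pos d) as H2d. assert (0 <= b) by apply pos_INR.
    set (y := vK * 2 ^ (n * d)) in *.
    assert (Hy : 0 < y) by now apply Rmult_lt_0_compat.
    assert (y * y <= 4 * (INR (length l) * INR (length l))) by nra.
    assert (INR (length Sig) * b <= y * 2 ^ d * b).
    { apply Rmult_le_compat_r; auto. unfold y. lra. }
    apply Rmult_le_reg_l with y; auto. lra. }
  assert (Hb0 : 0 < b).
  { pose proof (pow2_pos d). assert (0 < vK * 2 ^ (n * d)) by now apply Rmult_lt_0_compat.
    apply Rmult_lt_reg_l with (4 * 2 ^ d); lra. }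
  assert (HaE : INR (length A) = INR (length l) * (2 ^ j - 1) ^ d).
  { unfold A. now rewrite length_subdiv, mult_INR, pow_INR, INR_pow_sub1. }
  set (a := INR (length A)) in *.
  assert (Ha0 : 0 < a).
  { rewrite HaE. apply Rmult_lt_0_compat; auto. apply pow_lt. lra. }
  (* One factor 2 is lost in approximating [K] by the cubes of [l], another in shrinking them. *)
  assert (HF1 : vK * 2 ^ ((n + j) * d) <= 4 * a).
  { rewrite Nat.mul_add_distr_r, pow_add, HaE.
    pose proof (shrink_factor_ge_half d j Hj1) as Hh.
    apply Rmult_le_compat_r with (r := 2 ^ (j * d)) in Hh; [|lra].
    unfold Rdiv in Hh. rewrite Rmult_assoc, Rinv_l in Hh by lra.
    apply Rle_trans with (2 * INR (length l) * 2 ^ (j * d)).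
    - rewrite <- Rmult_assoc. apply Rmult_le_compat_r; lra.
    - assert (INR (length l) * 2 ^ (j * d) <= INR (length l) * (2 * (2 ^ j - 1) ^ d))
        by (apply Rmult_le_compat_l; lra). lra. }
  (* The product of 2^d, from the symmetrization, and (4d)^d, which bounds the scaling loss
     2^(jd). *)
  set (F := (8 * INR d) ^ d).
  assert (HF0 : 0 < F) by (apply pow_lt; lra).
  assert (HF2' : vK * 2 ^ ((n + j) * d) <= 4 * F * b).
  { rewrite Nat.mul_add_distr_r, pow_add, <- Rmult_assoc.
    assert (H4d : 2 ^ (j * d) <= (4 * INR d) ^ d) by (rewrite pow_mult; apply pow_incr; lra).
    replace F with (2 ^ d * (4 * INR d) ^ d) by (unfold F; rewrite <- Rpow_mult_distr; f_equal; ring).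
    apply Rle_trans with (4 * 2 ^ d * b * 2 ^ (j * d)); [apply Rmult_le_compat_r; lra|].
    replace (4 * (2 ^ d * (4 * INR d) ^ d) * b) with (4 * 2 ^ d * b * (4 * INR d) ^ d) by ring.
    apply Rmult_le_compat_l; auto. pose proof (pow2_pos d). nra. }
  destruct (vec_list_bound d (A ++ Sp)) as (M0 & HM0).
  (* Larger than every coordinate difference within [A] or within [Sp], so both embed in the
     torus. *)
  set (M := (2 * M0 + 1)%nat).
  assert (HM : (0 < M)%nat) by (unfold M; lia).
  assert (HlenA : forall z, In z A -> length z = d) by (intros z Hz; now apply in_subdiv in Hz).
  assert (HSpl : incl Sp l) by (intros z Hz; apply filter_In in Hz; apply Hz).
  assert (HndA : NoDup A) by (apply NoDup_subdiv; [apply Hl|auto]).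
  assert (HcA : forall y, (length A <= length (filter (modrel d M A y) (box d M)))%nat).
  { intros y. apply modrel_count; auto. intros z z' i Hz Hz' Hi.
    pose proof (HM0 z i (in_or_app _ _ _ (or_introl Hz)) Hi).
    pose proof (HM0 z' i (in_or_app _ _ _ (or_introl Hz')) Hi). unfold M. lia. }
  assert (HcS : forall y, (length Sp <= length (filter (modrel d M Sp y) (box d M)))%nat).
  { intros y. apply modrel_count; auto.
    - apply NoDup_filter, Hl.
    - intros z z' i Hz Hz' Hi.
      pose proof (HM0 z i (in_or_app _ _ _ (or_intror Hz)) Hi).
      pose proof (HM0 z' i (in_or_app _ _ _ (or_intror Hz')) Hi). unfold M. lia. }
  set (G := INR M ^ d).
  assert (HG : INR (length (box d M)) = G) by now rewrite length_box, pow_INR.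
  assert (HaG : a <= G).
  { rewrite <- HG. apply le_INR. apply Nat.le_trans with (1 := HcA []).
    apply filter_length_le. }
  assert (HG0 : 0 < G) by lra.
  set (rho := 2 * (INR k + ln F + 2)).
  assert (Hrho : rho = 2 * (INR k + INR d * ln (8 * INR d) + 2)).
  { unfold rho, F. rewrite ln_pow by lra. reflexivity. }
  assert (HlnF : 0 <= INR d * ln (8 * INR d)).
  { apply Rmult_le_pos; [lra|]. rewrite <- ln_1. apply Rlt_le, ln_increasing; lra. }
  assert (Hk1 : 1 <= INR k) by (apply (le_INR 1); lia).
  assert (Hm : exists m, rho * G / a <= INR m <= rho * G / a + 1).
  { exists (Z.to_nat (up (rho * G / a))). destruct (archimed (rho * G / a)) as [H1 H2].
    assert (0 <= rho * G / a).
    { apply Rmult_le_pos; [apply Rmult_le_pos; lra|]. left. now apply Rinv_0_lt_compat. }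
    assert (0 <= up (rho * G / a))%Z by (apply le_IZR; lra).
    rewrite INR_IZR_INZ, Z2Nat.id by auto. lra. }
  destruct Hm as (m & Hm1 & Hm2).
  destruct (cover_or_near_packing (box d M) (box d M) (fun t y => modrel d M A y t)
    (modrel d M Sp) a b k m) as (L & X & HL & _ & _ & HX & Hcov); auto.
  { intros E. rewrite E in HG. simpl in HG. lra. }
  { rewrite HG. exact HaG. }
  { intros y _. apply le_INR, HcA. }
  { intros y _. apply le_INR, HcS. }
  rewrite HG in HX. apply packing_bound with (F := F) in HX; auto.
  intros eps Heps.
  (* [vdec] is indexed by the dimension minus one. *)
  destruct d as [|e]; [lia|].
  assert (Hm0 : (0 < length L)%nat).
  { rewrite HL. apply INR_lt. apply Rlt_le_trans with (2 := Hm1). simpl (INR 0).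
    apply Rmult_lt_0_compat; [apply Rmult_lt_0_compat; lra|]. now apply Rinv_0_lt_compat. }
  exists (periodic e (n + j) M (length L + k * length X) (offset (S e) n j k L X s p)).
  split.
  - apply periodic_covering; [lia|intros; now apply offset_inRd|].
    apply torus_covering with l Sp; auto.
    intros z Hz. apply filter_In in Hz. now apply memb_In.
  - apply periodic_density with p j; auto; [lia|].
    intros vK' HvK'. replace vK' with vK by (eapply is_lub_u; eauto).
    set (H := 2 ^ ((n + j) * S e)) in *.
    rewrite plus_INR, mult_INR, HL. fold G.
    assert (HxH : INR (length X) * (vK * H) <= G).
    { apply Rle_trans with (2 := HX).
      replace (4 * (INR (length X) * b) * F) with (INR (length X) * (4 * F * b)) by ring.
      apply Rmult_le_compat_l; [apply pos_INR|auto]. }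
    assert (HmH : INR m * (vK * H) <= (4 * rho + 4) * G).
    { apply Rle_trans with ((rho * G / a + 1) * (4 * a)).
      - apply Rmult_le_compat; auto using pos_INR.
        apply Rmult_le_pos; [lra|]. left. apply pow2_pos.
      - replace ((rho * G / a + 1) * (4 * a)) with (4 * rho * G + 4 * a) by (field; lra). nra. }
    apply Rmult_le_reg_r with G; auto. unfold Rdiv. rewrite Rmult_assoc, Rinv_l by lra.
    rewrite Hrho in HmH.
    assert (INR k * (INR (length X) * (vK * H)) <= INR k * G) by (apply Rmult_le_compat_l; lra).
    assert (0 < eps * G) by now apply Rmult_lt_0_compat.
    lra.
Qed.

Lemma theta_le_mono d k K D D' : D <= D' -> theta_le d k K D -> theta_le d k K D'.
Proof.
  intros HD H eps Heps. destruct (H eps Heps) as (c & Hc & Hden). exists c. split; auto.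
  intros e1 He1. destruct (Hden e1 He1) as (R0 & HR). exists R0.
  intros r Hr vK vB HvK HvB l Hl Hin. specialize (HR r Hr vK vB HvK HvB l Hl Hin). lra.
Qed.

Theorem theorem1p3 (d : nat) (K : (nat -> R) -> Prop) (k : nat)
  (hd : (2 <= d)%nat) (hK : convex_body d K) (hk : (1 <= k)%nat)
  (hkd : INR k <= INR d * (ln (INR d) + ln (ln (INR d)))) :
  theta_le d k K
    (6 * exp 1 * INR d * (3 * ln (INR d) + ln (ln (INR d)) + 15)).
Proof.
  apply theta_le_mono with (1 := covering_bound d k hd hk hkd).
  apply theta_le_covering; auto. lia.
Qed.
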